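(* Let $d=2$, let $a\in(0,1)$, and let $\Gamma\subset\mathbb{R}^2$ be a regular $C^{1,\alpha}$-smooth planar curve without self-intersections. Let $\mathcal{M}_a$ be the set of all probability measures $\mu$ on $\mathbb{R}^2$ with $\mu(\Gamma)\ge a$, and let $$I[\mu]=\int\int\log\frac1{|x-y|}\,d\mu(x)\,d\mu(y)+\int |x|^2\,d\mu(x).$$ Then there is a unique minimizer $\mu_a\in\mathcal{M}_a$ of $I$, i.e. a unique $\mu_a\in\mathcal{M}_a$ such that $$I[\mu_a]=\inf_{\mu\in\mathcal{M}_a}I[\mu].$$
   Context: Here $\Gamma$ is a regular curve in $\mathbb{R}^2$ with locally finite length, and by abuse of notation $\Gamma:\mathbb{R}\to\mathbb{R}^2$ also denotes its arc-length parametrization, $|\dot\Gamma(t)|=1$ for $t\in\mathbb{R}$; $C^{1,\alpha}$ means that $\dot\Gamma$ is Hölder continuous with some exponent $\alpha\in(0,1)$. All measures are Borel measures. *)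

(* Defs.v *)
From HB Require Import structures.
From mathcomp Require Import all_boot all_order all_algebra.
From mathcomp Require Import all_classical all_reals all_analysis.
Set Implicit Arguments. Unset Strict Implicit. Unset Printing Implicit Defensive.
Import Order.TTheory GRing.Theory Num.Theory numFieldNormedType.Exports.
Local Open Scope classical_set_scope.
Local Open Scope ring_scope.

(* The plane is R * R.  Its library topology is the Euclidean one and its
   library sigma-algebra (the product one) is the Borel sigma-algebra, but its
   library norm is the max norm, hence the explicit Euclidean norm. *)
Definition enorm (R : realType) (x : R * R) : R :=
  Num.sqrt (x.1 ^+ 2 + x.2 ^+ 2).

Definition arc_length_parametrization (R : realType) (G : R -> R * R) : Prop :=
  forall t, derivable G t 1 /\ enorm (derive1 G t) = 1.

Definition C1_holder (R : realType) (alpha : R) (G : R -> R * R) : Prop :=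
  (forall t, derivable G t 1) /\
  exists C : R, forall s t,
    enorm (derive1 G s - derive1 G t) <= C * `|s - t| `^ alpha.

(* J is a parameter domain over which G runs exactly once through its range:
   the whole line for a curve infinite in both directions, a period for a
   closed curve, whose arc-length parametrization on the line is periodic. *)
Definition traversed_once (R : realType) (G : R -> R * R) (J : set R) : Prop :=
  {in J &, injective G} /\
  (J = setT \/
   exists L : R, [/\ 0 < L, forall t, G (t + L) = G t & J = `[0, L[%classic]).

Definition no_self_intersections (R : realType) (G : R -> R * R) : Prop :=
  exists J, traversed_once G J.

(* For an arc-length parametrization, the length of the part of the curve lying
   in K is the Lebesgue measure of the parameters in J sent to K. *)
Definition locally_finite_length (R : realType) (G : R -> R * R) : Prop :=
  forall J, traversed_once G J -> forall K : set (R * R), compact K ->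
    (lebesgue_measure (J `&` G @^-1` K) < +oo)%E.

(* Equal to +oo on the diagonal, as 0^-1 = +oo and lne +oo = +oo in \bar R. *)
Definition log_kernel (R : realType) (x y : R * R) : \bar R :=
  lne ((enorm (x - y))%:E^-1)%E.

Definition second_moment (R : realType) (mu : probability (R * R)%type R) :
    \bar R :=
  (\int[mu]_x ((enorm x ^+ 2)%:E))%E.

(* If the second moment is finite, the negative part of the kernel is integrable
   and the double integral is a well-defined element of ]-oo, +oo].  Otherwise
   the energy is +oo: log (1 / |x - y|) + (|x|^2 + |y|^2) / 2 is bounded below
   and its mu \x mu integral diverges.  dual_adde, for which
   -oo + +oo = +oo (adde yields -oo), gives this value. *)
Definition energy (R : realType) (mu : probability (R * R)%type R) : \bar R :=
  dual_adde (\int[mu]_y \int[mu]_x log_kernel x y)%E (second_moment mu).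

Definition curve_mass_ge (R : realType) (a : R) (G : R -> R * R) :
    set (probability (R * R)%type R) :=
  [set mu : probability (R * R)%type R | (a%:E <= mu (range G))%E].

(* Library measures are also defined, arbitrarily, on non-measurable sets, so
   two Borel measures are the same when they agree on measurable sets. *)
Definition same_measure (R : realType) (mu nu : probability (R * R)%type R) :
    Prop :=
  forall A : set (R * R), measurable A -> mu A = nu A.

(* Main.v *)
Require Import Defs.
From HB Require Import structures.
From mathcomp Require Import all_boot all_order all_algebra.
From mathcomp Require Import all_classical all_reals all_analysis.
From mathcomp Require Import measurable_realfun.
From mathcomp Require Import ring lra.
Import Order.TTheory GRing.Theory Num.Theory numFieldNormedType.Exports.
Local Open Scope classical_set_scope.
Local Open Scope ring_scope.

(** The proof rests on one identity.  Put N x = 1 + |x|^2 and let v x be the unit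
    vector (1, |x|^2, sqrt 2 x_1, sqrt 2 x_2) / N x of R^4, which is an affine
    image of the inverse stereographic projection of x to the sphere.  Then
    |x - y|^2 = N x * N y * (1 - <v x, v y>) with 0 <= <v x, v y> <= 1, and the
    Taylor series of the logarithm gives
      log (1 / |x - y|)
        = - (log N x + log N y) / 2 + 1/2 \sum_(k >= 1) <v x, v y>^k / k.
    The power <v x, v y>^k is the sum, over the k-tuples f of coordinates, of
    v^f x * v^f y, where v^f is the monomial of v with index f.  Integrating,
      I[mu] = \int (|x|^2 - log N) dmu
              + 1/2 \sum_(k >= 1) 1/k \sum_f (\int v^f dmu)^2   (energyE),
    a series of nonnegative terms: the first is linear in mu and the others are
    squares of integrals of bounded continuous functions.  The rest follows.

    Uniqueness.  By the parallelogram law for each square, the energy of the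
    midpoint of two minimizers falls short of the minimum by a positive multiple
    of the weighted sum of the squares of the differences of their moments
    (stereo_energy_midpoint).  So the two measures have the same moments
    \int v^f, and these determine a probability (moment_determinacy), because
    the half-planes {x_1 < a} and {x_2 < a} are given by strict linear
    inequalities in v, whose indicators are bounded pointwise limits of
    polynomials in v.

    Existence.  Along a minimizing sequence the term |x|^2 - log N bounds the
    second moments, so the sequence is tight.  An ultrafilter on the indices
    gives a limit to the masses of every set at once; this limit is only
    finitely additive, and the outer measure that it induces through open covers
    is a Borel probability tau, whose value on an open set is at most the limit
    (outer_regularization).  Hence the integrals of the v^f converge to those
    against tau, and the energy is lower semicontinuous, term by term
    (stereo_energy_lsc).  The constraint passes to the limit because the curve
    is closed: a locally finite length prevents the curve from returning
    infinitely often near a point (closed_curve_range).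

    Finiteness.  The minimum is finite because the arc-length measure of a short
    arc is admissible and gives mass O(r) to every disc of radius r
    (exists_frostman_measure); without it every admissible measure would be a
    minimizer. *)

Set Implicit Arguments. Unset Strict Implicit. Unset Printing Implicit Defensive.

(** * Borel sets of the plane *)

Section plane_borel.
Context {R : realType}.
Implicit Types (A : set (R * R)) (f : R * R -> R).

Lemma open_measurable_plane A : open A -> measurable A.
Proof.
move=> oA.
pose B (i : rat * rat * nat) : set (R * R) :=
  ball (ratr i.1.1 : R) i.2.+1%:R^-1 `*` ball (ratr i.1.2 : R) i.2.+1%:R^-1.
have -> : A = \bigcup_(i in [set i | B i `<=` A]) B i.
  apply/seteqP; split=> [[x y] Axy|]; last by move=> p [i BA Bp]; exact: BA.
  have : nbhs (x, y) A by exact: open_nbhs_nbhs.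
  move=> /nbhs_ballP[e /= e0 eA].
  have [n] : exists n : nat, n.+1%:R^-1 < e / 2 :> R.
    have [N _ HN] := near_infty_natSinv_lt (PosNum (divr_gt0 e0 (ltr0Sn R 1))).
    by exists N; exact: (HN N (leqnn N)).
  move=> ne.
  have [q1 q1x] : exists q : rat, ball x n.+1%:R^-1 (ratr q : R).
    have [] := @dense_rat R (ball x n.+1%:R^-1).
    - by exists x; apply: ballxx; rewrite invr_gt0.
    - by apply: ball_open.
    - by move=> z [h [q _ qz]]; exists q; rewrite qz.
  have [q2 q2y] : exists q : rat, ball y n.+1%:R^-1 (ratr q : R).
    have [] := @dense_rat R (ball y n.+1%:R^-1).
    - by exists y; apply: ballxx; rewrite invr_gt0.
    - by apply: ball_open.
    - by move=> z [h [q _ qz]]; exists q; rewrite qz.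
  exists (q1, q2, n); last by split; apply: ball_sym.
  move=> [z w] [/= Hz Hw]; apply: eA; split => /=.
    apply: (@le_ball _ _ _ (n.+1%:R^-1 + n.+1%:R^-1)); first by rewrite [leRHS]splitr lerD ?ltW.
    exact: ball_triangle q1x Hz.
  apply: (@le_ball _ _ _ (n.+1%:R^-1 + n.+1%:R^-1)); first by rewrite [leRHS]splitr lerD ?ltW.
  exact: ball_triangle q2y Hw.
rewrite bigcup_mkcond; apply: countable_bigcupT_measurable.
  exact: countableP.
move=> i; case: ifPn => // _.
by apply: measurableX; exact: measurable_ball.
Qed.

Lemma closed_measurable_plane A : closed A -> measurable A.
Proof.
by move=> cA; rewrite -[A]setCK; apply: measurableC; apply: open_measurable_plane;
  exact: closed_openC.
Qed.

Lemma continuous_measurable_plane f :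
  continuous f -> measurable_fun [set: R * R] f.
Proof.
move=> cf; apply: (measurability _ (RGenOInfty.measurableE R)) => //.
move=> _ [_ [x ->] <-]; rewrite setTI; apply: open_measurable_plane.
apply: open_comp => //; exact: open_gt.
Qed.

End plane_borel.

(** * From finitely additive set functions to Borel probabilities *)

(** A finitely additive probability m that is tight is turned into a Borel
    probability in the way of Caratheodory, starting from the values of m on open
    sets: compactness keeps the total mass, and the continuity of the coordinates
    makes the Borel sets measurable. *)
Section regularization.
Local Open Scope ereal_scope.
Context {R : realType} (m : set (R * R) -> R).
Hypothesis m_ge0 : forall A, measurable A -> (0 <= m A)%R.
Hypothesis mU : forall A B, measurable A -> measurable B ->
  A `&` B = set0 -> m (A `|` B) = (m A + m B)%R.
Hypothesis mT : m setT = 1%R.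
Hypothesis m_tight : forall e, (0 < e)%R -> exists2 K, compact K & (1 - e <= m K)%R.
Implicit Types A B V : set (R * R).

Let m_le A B : measurable A -> measurable B -> A `<=` B -> (m A <= m B)%R.
Proof.
move=> mA mB AB; rewrite -(setDUK AB) mU//; last by rewrite setDIK.
  by rewrite lerDl m_ge0//; exact: measurableD.
exact: measurableD.
Qed.

Let m0 : m set0 = 0%R.
Proof.
have := mU (@measurable0 _ (R * R)%type) (@measurable0 _ (R * R)%type) (setI0 _).
by rewrite setU0 => /eqP; rewrite addrC -subr_eq subrr => /eqP <-.
Qed.

Let setU_setD A B : A `|` (B `\` A) = A `|` B.
Proof.
apply/seteqP; split=> x [Ax|]; [by left|by case; right|by left|].
by have [?|?] := pselect (A x); [left|right].
Qed.

Let m_subadd (V : (set (R * R))^nat) n : (forall k, open (V k)) ->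
  (m (\big[setU/set0]_(k < n) V k) <= \sum_(k < n) m (V k))%R.
Proof.
move=> oV; elim: n => [|n IH]; first by rewrite !big_ord0 m0.
rewrite !big_ord_recr/= -setU_setD//.
have mV k : measurable (V k) by exact: open_measurable_plane.
have mW : measurable (\big[setU/set0]_(k < n) V k) by exact: bigsetU_measurable.
rewrite mU//; [|exact: measurableD|by rewrite setDIK].
by rewrite lerD// m_le//; exact: measurableD.
Qed.

(** The infimum over open supersets makes coverings by arbitrary Borel sets as
    good as coverings by open sets, so that [mu_ext] applies to it directly and
    compactness can still be used. *)
Definition open_hull A : \bar R :=
  ereal_inf [set (m V)%:E | V in [set V | open V /\ A `<=` V]].

Let open_hull_ge0 A : 0 <= open_hull A.
Proof.
apply: le_ereal_inf_tmp => _ [V [oV _] <-]; rewrite lee_fin m_ge0//.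
exact: open_measurable_plane.
Qed.

Let open_hull_le A V : open V -> A `<=` V -> open_hull A <= (m V)%:E.
Proof. by move=> oV AV; apply: ereal_inf_lbound; exists V. Qed.

Let open_hull0 : open_hull set0 = 0.
Proof.
apply/eqP; rewrite eq_le open_hull_ge0 andbT.
by apply: (le_trans (open_hull_le open0 (@sub0set _ set0))); rewrite m0.
Qed.

Let open_hull_adherent A (e : R) : (0 < e)%R ->
  exists V, [/\ open V, A `<=` V & (m V)%:E <= open_hull A + e%:E].
Proof.
move=> e0.
have hf : open_hull A \is a fin_num.
  rewrite ge0_fin_numE//; apply: le_lt_trans (open_hull_le openT (@subsetT _ A)) _.
  exact: ltry.
have [_ [V [oV AV] <-] /ltW h] := lb_ereal_inf_adherent e0 hf.
by exists V.
Qed.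

Definition hull_outer A : \bar R := mu_ext open_hull A.

HB.instance Definition _ := isOuterMeasure.Build R (R * R)%type hull_outer
  (mu_ext0 open_hull0 open_hull_ge0) (mu_ext_ge0 open_hull_ge0)
  (le_mu_ext open_hull) (mu_ext_sigma_subadditive open_hull_ge0).

Lemma hull_outer_open V : open V -> hull_outer V <= (m V)%:E.
Proof.
move=> oV; apply: (@le_trans _ _ (open_hull V)); last exact: open_hull_le.
apply: ereal_inf_lbound; exists (fun n => if n is 0%N then V else set0).
  split; last by move=> t Vt; exists 0%N.
  by move=> [|n]//=; exact: open_measurable_plane.
rewrite nneseries_recl//.
rewrite eseries_cond/= eseries0 ?adde0// => -[|i]//= _ _; exact: open_hull0.
Qed.

Let hull_outer_ge c A :
  (forall F, (forall k, measurable (F k)) -> A `<=` \bigcup_k F k ->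
    c <= \sum_(k <oo) open_hull (F k)) -> c <= hull_outer A.
Proof. by move=> h; apply: le_ereal_inf_tmp => _ [F [mF AF] <-]; exact: h. Qed.

(** A countable open cover of a compact set has a finite subcover, and m is finitely
    subadditive: compactness makes up for the countable additivity that m lacks. *)
Lemma hull_outer_compact K : compact K -> (m K)%:E <= hull_outer K.
Proof.
move=> cK; apply: hull_outer_ge => F mF KF; apply/lee_addgt0Pr => e e0.
have mK : measurable K.
  by apply: closed_measurable_plane; exact: compact_closed cK.
have e2 k : (0 < e / (2 ^ k.+1)%:R)%R by rewrite divr_gt0// ltr0n expn_gt0.
have [V HV] := choice (fun k => open_hull_adherent (F k) (e2 k)).
have [N KN] : exists N, K `<=` \big[setU/set0]_(k < N) V k.
  have /compact_near_coveringP/(_ nat \oo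
    (fun n x => (\big[setU/set0]_(k < n) V k) x)) := cK.
  case => [x /KF [k _ /(let: And3 _ h _ := HV k in h) Vx]|N _ HN].
    exists (V k, [set n | (k < n)%N]) => /=.
      split; last by exists k.+1.
      by apply: open_nbhs_nbhs; split => //; case: (HV k).
    move=> [y n] /= [Vy kn]; rewrite -bigcup_mkord.
    by exists k.
  by exists N; apply: HN => /=.
apply: (@le_trans _ _ (\sum_(k <oo) (open_hull (F k) + (e / (2 ^ k.+1)%:R)%:E)));
  last by apply: epsilon_trick => //; exact: ltW.
apply: (@le_trans _ _ (\sum_(0 <= k < N) (m (V k))%:E)); last first.
  apply: (@le_trans _ _ (\sum_(0 <= k < N) (open_hull (F k) + (e / (2 ^ k.+1)%:R)%:E))).
    by apply: lee_sum => k _; case: (HV k).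
  apply: nneseries_lim_ge => k _ _.
  by rewrite adde_ge0// lee_fin ltW.
rewrite sumEFin lee_fin big_mkord.
have oV k : open (V k) by case: (HV k).
apply: le_trans (m_subadd _ oV); apply: m_le => //.
by apply: bigsetU_measurable => k _; exact: open_measurable_plane.
Qed.

Let hull_outer_setT : hull_outer setT = 1.
Proof.
apply/eqP; rewrite eq_le; apply/andP; split.
  by apply: (le_trans (hull_outer_open openT)); rewrite mT.
apply/lee_addgt0Pr => e e0; have [K cK Ke] := m_tight e0.
apply: (@le_trans _ _ ((m K)%:E + e%:E)).
  by rewrite -EFinD lee_fin -lerBlDr.
rewrite leeD2r//; apply: le_trans (hull_outer_compact cK) _.
exact: le_outer_measure.
Qed.

Section superlevel.
Variables (p : R * R -> R) (cp : continuous p).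

(** Two disjoint open sets separate A from B, and each open set of a cover splits
    along them. *)
Lemma hull_outer_separated A B (c d : R) : (c < d)%R ->
  A `<=` [set x | p x <= c]%R -> B `<=` [set x | d <= p x]%R ->
  hull_outer A + hull_outer B <= hull_outer (A `|` B).
Proof.
move=> cd Ac Bd; apply: hull_outer_ge => F mF ABF.
pose P := [set x | p x < (c + d) / 2]%R; pose Q := [set x | (c + d) / 2 < p x]%R.
have oP : open P by apply: (@open_comp _ _ p [set y | y < _]%R) => //; exact: open_lt.
have oQ : open Q by apply: (@open_comp _ _ p [set y | _ < y]%R) => //; exact: open_gt.
have mP : measurable P by exact: open_measurable_plane.
have mQ : measurable Q by exact: open_measurable_plane.
have PQ0 : P `&` Q = set0.
  by apply/seteqP; split => // x [/= /lt_trans h /h]; rewrite ltxx.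
apply: (@le_trans _ _
  (\sum_(k <oo) (open_hull (F k `&` P) + open_hull (F k `&` Q)))); last first.
  apply: lee_nneseries => [k _ _|k _]; first exact: adde_ge0.
  apply: le_ereal_inf_tmp => _ [V [oV FV] <-].
  apply: (@le_trans _ _ ((m (V `&` P))%:E + (m (V `&` Q))%:E)).
    apply: leeD; apply: open_hull_le; try exact: openI; exact: setSI.
  have mV : measurable V by exact: open_measurable_plane.
  rewrite -EFinD lee_fin -mU; try exact: measurableI.
    apply: m_le => //; last by rewrite -setIUr; exact: subIsetl.
    by apply: measurableU; exact: measurableI.
  by rewrite setIACA PQ0 setI0.
rewrite nneseriesD//; apply: leeD; apply: ereal_inf_lbound.
  exists (fun k => F k `&` P) => //; split; first by move=> k; exact: measurableI.
  move=> x Ax; have [k _ Fk] := ABF x (or_introl Ax); exists k => //; split => //.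
  by have /= := Ac _ Ax; rewrite /P/=; move: cd; lra.
exists (fun k => F k `&` Q) => //; split; first by move=> k; exact: measurableI.
move=> x Bx; have [k _ Fk] := ABF x (or_intror Bx); exists k => //; split => //.
by have /= := Bd _ Bx; rewrite /Q/=; move: cd; lra.
Qed.

Let tau_fin A : hull_outer A \is a fin_num.
Proof.
rewrite ge0_fin_numE//; last exact: outer_measure_ge0.
have : hull_outer A <= hull_outer setT by exact: le_outer_measure.
by move=> /le_lt_trans; apply; rewrite hull_outer_setT ltry.
Qed.

(** Caratheodory's argument for metric outer measures: outside of {p <= c} the
    set X is exhausted by sets at a positive distance from {p <= c}, and the
    layers D k in between have a convergent sum of outer measures, since the
    layers of the same parity are separated from each other. *)
Lemma hull_outer_caratheodory c : caratheodory_measurable hull_outer [set x | p x <= c]%R.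
Proof.
apply: le_caratheodory_measurable => X.
set C := [set x | p x <= c]%R.
pose r k : R := (c + k.+1%:R^-1)%R.
have r_lt i j : (i < j)%N -> (r j < r i)%R.
  by move=> ij; rewrite ltrD2l ltf_pV2 ?posrE ?ltr0n// ltr_nat.
have r_le i j : (i <= j)%N -> (r j <= r i)%R.
  by rewrite leq_eqVlt => /predU1P[->//|/r_lt/ltW].
pose D k := X `&` [set x | r k.+1 <= p x < r k]%R.
(* The layers D b, D (b + 2), D (b + 4), ... are separated by the layers of the
   other parity. *)
have sumD b n : \sum_(0 <= k < n) hull_outer (D (k.*2 + b)%N) <=
    hull_outer (\big[setU/set0]_(0 <= k < n) D (k.*2 + b)%N).
  elim: n => [|[|n] IH]; first by rewrite !big_geq// outer_measure0.
    by rewrite !big_nat1.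
  rewrite big_nat_recr// [X in _ <= hull_outer X]big_nat_recr//= addeC.
  rewrite (setUC (\big[setU/set0]_(0 <= k < n.+1) _)).
  apply: (@le_trans _ _ (hull_outer (D (n.+1.*2 + b)%N) +
    hull_outer (\big[setU/set0]_(0 <= k < n.+1) D (k.*2 + b)%N))).
    by rewrite leeD2l.
  apply: (@hull_outer_separated _ _ (r (n.+1.*2 + b)%N) (r (n.*2.+1 + b)%N)).
  - by apply: r_lt; rewrite doubleS !addSn.
  - by move=> x [_ /= /andP[_ /ltW]].
  - rewrite big_mkord -(bigcup_mkord _ (fun k => D (k.*2 + b)%N)) => x [k /= kn [_ /= /andP[+ _]]].
    by apply: le_trans; apply: r_le; rewrite -addSn leq_add2r ltnS leq_double -ltnS.
have sumD2 n : \sum_(0 <= k < n) hull_outer (D k) <= hull_outer X + hull_outer X.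
  have DX b k : hull_outer (\big[setU/set0]_(0 <= k < n) D (k.*2 + b)%N) <= hull_outer X.
    apply: le_outer_measure; rewrite big_mkord -(bigcup_mkord _ (fun k => D (k.*2 + b)%N)).
    by move=> x [i _ []].
  apply: (@le_trans _ _ (\sum_(0 <= k < n.*2) hull_outer (D k))).
    rewrite [leRHS](@big_cat_nat _ _ _ n)//=; last by rewrite -addnn leq_addr.
    by rewrite leeDl// sume_ge0// => k _; exact: outer_measure_ge0.
  apply: (@le_trans _ _ (\sum_(0 <= k < n) hull_outer (D (k.*2 + 0)%N) +
     \sum_(0 <= k < n) hull_outer (D (k.*2 + 1)%N))); last first.
    by apply: leeD; apply: le_trans (sumD _ _) _; exact: DX.
  rewrite -big_split/=; elim: (n) => [|j IH]; first by rewrite !big_geq.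
  rewrite doubleS !big_nat_recr//= -addeA; apply: leeD => //.
  by rewrite addn0 addn1.
have sumD_fin : \sum_(k <oo) hull_outer (D k) < +oo.
  apply: (@le_lt_trans _ _ (hull_outer X + hull_outer X)).
    apply: lime_le; first by apply: is_cvg_nneseries => *; exact: outer_measure_ge0.
    exact: nearW.
  by rewrite -ge0_fin_numE ?adde_ge0// ?outer_measure_ge0// fin_numD !tau_fin.
have tail : \sum_(N <= k <oo) hull_outer (D k) @[N --> \oo] --> 0.
  by apply: nneseries_tail_cvg => // k _; exact: outer_measure_ge0.
apply/lee_addgt0Pr => e e0.
have [N HN] : exists N, \sum_(N <= k <oo) hull_outer (D k) <= e%:E.
  have /fine_cvgP[[N1 _ fN] /cvgrPdist_lt /(_ e e0)[N2 _ H]] := tail.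
  exists (maxn N1 N2); have := H (maxn N1 N2) (leq_maxr _ _).
  rewrite /= sub0r normrN => /ltW /(le_trans (ler_norm _)).
  by rewrite -lee_fin fineK//; exact: (fN _ (leq_maxl _ _)).
pose Y := X `&` [set x | r N <= p x]%R.
have XC : hull_outer (X `&` C) + hull_outer Y <= hull_outer X.
  apply: le_trans (@hull_outer_separated _ _ c (r N) _ _ _) _.
  - by rewrite ltrDl invr_gt0 ltr0n.
  - by move=> x [].
  - by move=> x [].
  - by apply: le_outer_measure => x [[]|[]].
have XY : hull_outer (X `&` ~` C) <= hull_outer Y + e%:E.
  apply: (@le_trans _ _ (hull_outer (Y `|` \bigcup_(k in ~` `I_N) D k))); last first.
    apply: le_trans (outer_measureU2 hull_outer _ _) _.
    rewrite leeD2l//; apply: le_trans HN.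
    exact: (outer_measure_sigma_subadditive_tail hull_outer).
  apply: le_outer_measure => x [Xx /= /negP]; rewrite -ltNge => cx.
  have [rx|rx] := leP (r N) (p x); first by left.
  right.
  have : exists k, (r k <= p x)%R.
    have px0 : (0 < p x - c)%R by rewrite subr_gt0.
    have [M _ HM] := near_infty_natSinv_lt (PosNum px0).
    exists M; have /= := HM M (leqnn M).
    by rewrite /r ltrBrDl => /ltW.
  move=> /ex_minnP[k rk kmin].
  have Nk : (N < k)%N.
    by rewrite ltnNge; apply/negP => /r_le h; move: rx; rewrite ltNge (le_trans h rk).
  case: k Nk rk kmin => // k Nk rk kmin.
  exists k => /=; first by apply/negP; rewrite -leqNgt -ltnS.
  split => //=; rewrite rk/= ltNge; apply/negP => /kmin.
  by rewrite ltnn.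
apply: le_trans (leeD2l _ XY) _.
by rewrite addeA leeD2r.
Qed.

End superlevel.

Let rays_caratheodory (p : R * R -> R) : continuous p ->
  preimage_set_system setT p measurable `<=` caratheodory_measurable hull_outer.
Proof.
move=> cp _ [B mB <-]; rewrite setTI.
have {mB} : (@RGenOInfty.G R).-sigma.-measurable B by rewrite -RGenOInfty.measurableE.
move: B; apply: smallest_sub.
  split => /=.
  - by rewrite preimage_set0; exact: caratheodory_measurable_set0.
  - by move=> A cA; rewrite setTD preimage_setC; exact: caratheodory_measurable_setC.
  - by move=> F cF; rewrite preimage_bigcup; exact: caratheodory_measurable_bigcup.
move=> _ [c ->]; rewrite -[_ @^-1` _]setCK; apply: caratheodory_measurable_setC.
rewrite [X in caratheodory_measurable _ X](_ : _ = [set x | p x <= c]%R).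
  exact: hull_outer_caratheodory.
by apply/seteqP; split=> x /=; rewrite in_itv/= andbT leNgt => /negP.
Qed.

Lemma measurable_hull_outer_caratheodory A :
  measurable A -> caratheodory_measurable hull_outer A.
Proof.
move: A; apply: smallest_sub.
  split.
  - exact: caratheodory_measurable_set0.
  - by move=> A cA; rewrite setTD; exact: caratheodory_measurable_setC.
  - by move=> F cF; exact: caratheodory_measurable_bigcup.
by rewrite subUset; split; apply: rays_caratheodory => x; [exact: cvg_fst|exact: cvg_snd].
Qed.

(** A second name for the outer measure, which carries the structure of a measure
    on the Borel sets. *)
Definition hull_measure : set (R * R) -> \bar R := hull_outer.

Let hull_measure0 : hull_measure set0 = 0. Proof. exact: outer_measure0. Qed.
Let hull_measure_ge0 A : 0 <= hull_measure A. Proof. exact: outer_measure_ge0. Qed.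
Let hull_measure_sigma_additive : semi_sigma_additive hull_measure.
Proof.
move=> F mF tF mUF; apply: caratheodory_measure_sigma_additive => //.
  by move=> n; exact: measurable_hull_outer_caratheodory.
exact: measurable_hull_outer_caratheodory.
Qed.

HB.instance Definition _ := isMeasure.Build _ _ _ hull_measure
  hull_measure0 hull_measure_ge0 hull_measure_sigma_additive.

HB.instance Definition _ :=
  Measure_isProbability.Build _ _ _ hull_measure hull_outer_setT.

(** The inequality on open sets alone is what yields the semicontinuity of
    integrals later on; equality would fail, as mass can concentrate on the
    boundary. *)
Lemma outer_regularization : exists tau : probability (R * R)%type R,
  forall V, open V -> tau V <= (m V)%:E.
Proof. by exists hull_measure => V oV; exact: hull_outer_open. Qed.

End regularization.

(** * Limits of probabilities along an ultrafilter *)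

Lemma integral_cst_prob d (T : measurableType d) (R : realType)
  (P : probability T R) (r : R) : (\int[P]_x r%:E = r%:E)%E.
Proof. by rewrite (integral_cst P measurableT r%:E) [X in (_ * X)%E](@probability_setT _ _ _ P) mule1. Qed.

Section ultralimit.
Context {R : realType} (U : set_system nat) {FU : UltraFilter U}.
Implicit Types mu tau : probability (R * R)%type R.

Lemma ultra_bounded_cvg (u : nat -> R) a b :
  (forall n, a <= u n <= b) -> cvg (u n @[n --> U]).
Proof.
move=> ab.
have [] := @segment_compact R a b (u @ U).
  by apply: (@filterE _ U) => n; rewrite /= in_itv/= ab.
move=> l [_ cl]; apply/cvg_ex; exists l; apply/cvgrPdist_lt => e e0.
have [//|H] := in_ultra_setVsetC [set n | `|l - u n| < e] FU.
have [] := cl [set y | ~ (`|l - y| < e)] (ball l e) H (nbhsx_ballx _ _ e0).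
by move=> y [].
Qed.

(** This is the portmanteau form of weak convergence along U, the limit of the
    masses of an open set being part of the data. *)
Definition portmanteau_limit (mu_ : nat -> probability (R * R)%type R) tau :=
  forall V, open V -> exists2 l : R,
    fine (mu_ n V) @[n --> U] --> l & (tau V <= l%:E)%E.

Section tight.
Variable mu_ : nat -> probability (R * R)%type R.

Let w A : R := lim (fine (mu_ n A) @[n --> U]).

Let fine01 mu A : measurable A -> 0 <= fine (mu A) <= 1.
Proof.
move=> mA; rewrite fine_ge0//= -lee_fin fineK ?fin_num_measure//.
exact: probability_le1.
Qed.

Let wP A : measurable A -> fine (mu_ n A) @[n --> U] --> w A.
Proof. by move=> mA; apply: (@ultra_bounded_cvg _ 0 1) => n; exact: fine01. Qed.

(** Along an ultrafilter the masses of all Borel sets converge simultaneously, so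
    that the limits form a finitely additive set function, which is then
    regularized. *)
Lemma tight_portmanteau_limit :
  (forall e, 0 < e -> exists2 K, compact K & forall n, ((1 - e)%:E <= mu_ n K)%E) ->
  exists tau, portmanteau_limit mu_ tau.
Proof.
move=> tight.
have [||||tau tauV] := @outer_regularization R w.
- move=> A mA; apply: limr_ge; first exact: wP.
  by apply: filterE => n; have /andP[] := fine01 (mu_ n) mA.
- move=> A B mA mB AB0; apply/cvg_lim => //.
  rewrite (_ : (fun _ => _) = (fun n => fine (mu_ n A) + fine (mu_ n B))).
    by apply: cvgD; exact: wP.
  apply/funext => n; rewrite measureU// fineD//; exact: fin_num_measure.
- apply/cvg_lim => //; apply: cvg_near_cst; apply: filterE => n.
  by rewrite probability_setT.
- move=> e e0; have [K cK HK] := tight e e0; exists K => //.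
  have mK : measurable K.
    by apply: closed_measurable_plane; exact: compact_closed cK.
  apply: limr_ge; first exact: wP.
  by apply: filterE => n; rewrite -lee_fin fineK ?fin_num_measure.
exists tau => V oV; exists (w V); last exact: tauV.
by apply: wP; exact: open_measurable_plane.
Qed.

End tight.

Section portmanteau.
Variables (mu_ : nat -> probability (R * R)%type R) (tau : probability (R * R)%type R).
Hypothesis mu_tau : portmanteau_limit mu_ tau.

Lemma portmanteau_closed (F : set (R * R)) (c : R) : closed F ->
  (\forall n \near U, (c%:E <= mu_ n F)%E) -> (c%:E <= tau F)%E.
Proof.
move=> cF H.
have oF : open (~` F) by exact: closed_openC.
have mF : measurable F by exact: closed_measurable_plane.
have [l lP taul] := mu_tau oF.
have l1 : l <= 1 - c.
  apply: (@closed_cvg _ _ U _ _ (fun x => x <= 1 - c)); [exact: closed_le| |exact: lP].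
  near=> n.
  rewrite probability_setC// fineB//; last exact: fin_num_measure.
  rewrite lerD2l lerN2 -lee_fin fineK ?fin_num_measure//.
  by near: n.
have : (tau (~` F) <= (1 - c)%:E)%E by apply: le_trans taul _; rewrite lee_fin.
rewrite probability_setC// -(fineK (fin_num_measure tau _ mF)) -EFinB !lee_fin.
lra.
Unshelve. all: by end_near. Qed.

Let step (d : R) (g : R * R -> R) k := [set x | k.+1%:R * d < g x].

Let sum_step_le d g K x : 0 < d -> 0 <= g x ->
  \sum_(0 <= k < K) d * \1_(step d g k) x <= g x.
Proof.
move=> d0 g0; elim: K => [|K IH]; first by rewrite big_geq.
rewrite big_nat_recr//= [X in _ + d * X]indicE.
have [|_] := boolP (x \in step d g K); last by rewrite mulr0 addr0.
rewrite inE /step/= => /ltW; apply: le_trans; rewrite mulr1 -(natr1 K) mulrDl mul1r lerD2r.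
rewrite mulr_natl -[K in X in _ <= X]subn0 -iter_addr_0 -big_const_nat.
apply: ler_sum => k _; rewrite ler_piMr ?(ltW d0)// indicE.
Qed.

Let le_sum_step d g K x : 0 < d -> 0 <= g x -> g x <= K.+1%:R * d ->
  g x <= d + \sum_(0 <= k < K) d * \1_(step d g k) x.
Proof.
move=> d0 g0; elim: K => [|K IH]; first by rewrite big_geq// mul1r addr0.
move=> gK; have [/IH|gK'] := leP (g x) (K.+1%:R * d).
  move=> /le_trans; apply; rewrite lerD2l big_nat_recr//= lerDl.
  by rewrite mulr_ge0 ?(ltW d0).
apply: (le_trans gK); rewrite -(natr1 K.+1) mulrDl mul1r addrC lerD2l.
rewrite [leRHS](_ : _ = \sum_(0 <= k < K.+1) d).
  by rewrite big_const_nat subn0 iter_addr_0 mulr_natl.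
apply: eq_big_nat => k /andP[_ kK]; rewrite indicE mem_set ?mulr1//.
by apply: le_lt_trans gK'; rewrite ler_pM2r// ler_nat.
Qed.

(** The superlevel sets {k d < g} of g are open, and d times the number of those
    that contain x differs from g x by at most d: integrating this step function
    reduces the claim to open sets. *)
Lemma portmanteau_integral (g : R * R -> R) (c : R) :
  continuous g -> (forall x, 0 <= g x) ->
  (\forall n \near U, (\int[mu_ n]_x (g x)%:E <= c%:E)%E) ->
  (\int[tau]_x (g x)%:E <= c%:E)%E.
Proof.
move=> cg g0 H; apply/lee_addgt0Pr => d d0.
have oV k : open (step d g k).
  by apply: (@open_comp _ _ g [set y | _ < y]) => //; exact: open_gt.
have mV k : measurable (step d g k) by exact: open_measurable_plane.
have mstep k : measurable_fun setT (fun x => (d * \1_(step d g k) x)%:E).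
  by apply/measurable_EFinP; apply: measurable_funM => //; exact: measurable_indic.
have step0 k x : (0 <= (d * \1_(step d g k) x)%:E)%E.
  by rewrite lee_fin mulr_ge0 ?(ltW d0).
have istep (mu : probability (R * R)%type R) k :
    (\int[mu]_x (d * \1_(step d g k) x)%:E = d%:E * mu (step d g k))%E.
  under eq_integral do rewrite EFinM.
  rewrite ge0_integralZl_EFin//; last 2 first.
    by apply/measurable_EFinP; exact: measurable_indic.
    exact: ltW.
  by rewrite integral_indic// setIT.
have mg : measurable_fun setT (EFin \o g).
  by apply/measurable_EFinP; exact: continuous_measurable_plane.
have [l lP] := choice (fun k => let: ex_intro2 l h1 h2 := mu_tau (oV k) in
  ex_intro (fun l : R => fine (mu_ n (step d g k)) @[n --> U] --> l /\
    (tau (step d g k) <= l%:E)%E) l (conj h1 h2)).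
apply: (@le_trans _ _ (\int[tau]_x (d%:E + \sum_(k <oo) (d * \1_(step d g k) x)%:E))%E).
  apply: ge0_le_integral => //.
  - by move=> x _; rewrite lee_fin.
  - by apply: emeasurable_funD => //; exact: ge0_emeasurable_sum.
  - move=> x _; have [K gK] : exists K : nat, g x <= K.+1%:R * d.
      exists (Num.trunc (g x / d)); rewrite -ler_pdivrMr//; apply: ltW.
      exact: truncnS_gt.
    apply: (@le_trans _ _ (d + \sum_(0 <= k < K) d * \1_(step d g k) x)%:E).
      by rewrite lee_fin; exact: le_sum_step.
    rewrite EFinD leeD2l// -sumEFin; apply: nneseries_lim_ge => k _ _.
    exact: step0.
rewrite ge0_integralD//; last 3 first.
  - by move=> x _; rewrite lee_fin ltW.
  - by move=> x _; exact: nneseries_ge0.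
  - exact: ge0_emeasurable_sum.
rewrite integral_cst_prob addeC leeD2r//.
rewrite integral_nneseries//; apply: lime_le.
  by apply: is_cvg_nneseries => k _ _; exact: integral_ge0.
apply: nearW => K; under eq_bigr do rewrite istep.
apply: (@le_trans _ _ (\sum_(0 <= k < K) d * l k)%:E).
  rewrite -sumEFin; apply: lee_sum => k _; rewrite EFinM lee_pmul2l//.
  by case: (lP k).
rewrite lee_fin.
apply: (@closed_cvg _ _ U _ (fun n => \sum_(0 <= k < K) d * fine (mu_ n (step d g k)))
  (fun x => x <= c)); [exact: closed_le| |]; last first.
  apply: cvg_big => [|k _]; last by apply: cvgMr; case: (lP k).
  exact: add_continuous.
near=> n.
have Hn : (\int[mu_ n]_x (g x)%:E <= c%:E)%E by near: n.
rewrite -lee_fin; apply: le_trans Hn.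
rewrite -sumEFin.
under eq_bigr do rewrite EFinM fineK ?fin_num_measure// -istep.
rewrite -ge0_integral_sum//; apply: ge0_le_integral => //.
- by move=> x _; apply: sume_ge0.
- exact: emeasurable_sum.
- by move=> x _; rewrite sumEFin lee_fin sum_step_le.
Unshelve. all: by end_near. Qed.

End portmanteau.
End ultralimit.

(** * The logarithmic series *)

(** The remainder of the Taylor series of - ln (1 - u) is estimated by the mean
    value theorem; the value at u = 1 is obtained by comparison. *)
Section logarithm.
Context {R : realType}.
Implicit Types u t : R.

Let P n t : R := \sum_(0 <= k < n) t ^+ k.+1 / k.+1%:R.

Let is_derive_P n t : is_derive t 1 (P n) (\sum_(0 <= k < n) t ^+ k).
Proof.
elim: n => [|n IH].
  rewrite big_geq// (_ : P 0 = cst 0); first exact: is_derive_cst.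
  by apply/funext => s; rewrite /P big_geq.
rewrite big_nat_recr//=.
have -> : P n.+1 = P n + n.+1%:R^-1 *: (@id R) ^+ n.+1.
  apply/funext => s; rewrite /P big_nat_recr//= mulrC; congr (_ + _ * _).
  by elim: (n.+1) => [|j h]; rewrite ?expr0// !exprS h.
apply: is_deriveD; apply: is_derive_eq.
rewrite /GRing.scale /= mulr1 mulrA mulVf ?mul1r ?pnatr_eq0//.
Qed.

Lemma log_series_bounds n u : 0 <= u < 1 ->
  0 <= - ln (1 - u) - P n u <= u ^+ n.+1 / (1 - u).
Proof.
move=> /andP[u0 u1].
pose g := (fun t : R => - ln (1 - t)) - P n.
have dg t : t < 1 -> is_derive t 1 g (t ^+ n / (1 - t)).
  move=> t1; have t10 : 0 < 1 - t by rewrite subr_gt0.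
  have -> : t ^+ n / (1 - t) = (1 - t)^-1 - \sum_(0 <= k < n) t ^+ k.
    apply: (@mulIf _ (1 - t)); first by rewrite gt_eqF.
    rewrite divfK ?gt_eqF// mulrBl mulVf ?gt_eqF// [X in _ - X]mulrC.
    by rewrite big_mkord -[1 - t]opprB mulNr -subrX1 opprK subrKC.
  apply: is_deriveB; last exact: is_derive_P.
  have h : is_derive (1 - t) 1 (@ln R) (1 - t)^-1.
    exact: is_derive1_ln.
  have h2 : is_derive t 1 (fun s : R => 1 - s) (0 - 1) by apply: is_deriveB.
  have := is_deriveN (@is_derive1_comp R (@ln R) (fun s => 1 - s) t _ _ h h2).
  by rewrite sub0r mulrN1 opprK; apply.
have cg : {within `[0, u], continuous g}.
  apply: derivable_within_continuous => s; rewrite in_itv/= => /andP[_ tu].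
  by have [] := dg _ (le_lt_trans tu u1).
have [s|c] := @MVT_segment R g (fun t => t ^+ n / (1 - t)) 0 u u0 _ cg.
  by rewrite in_itv/= => /andP[_ su]; apply: dg; exact: lt_trans su u1.
rewrite in_itv/= => /andP[c0 cu].
have -> : g 0 = 0.
  rewrite /g /= !fctE subr0 ln1 oppr0 /P big1 ?subr0// => k _.
  by rewrite expr0n mul0r.
rewrite !subr0 => gu.
have -> : - ln (1 - u) - P n u = c ^+ n / (1 - c) * u by rewrite -gu.
have c1 : c < 1 by exact: le_lt_trans u1.
rewrite mulr_ge0 ?divr_ge0 ?exprn_ge0 ?subr_ge0 ?(ltW c1)//=.
have -> : u ^+ n.+1 / (1 - u) = u ^+ n / (1 - u) * u by rewrite exprSr mulrAC.
rewrite ler_wpM2r// ler_pM ?exprn_ge0 ?invr_ge0 ?subr_ge0 ?(ltW c1)//.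
  by rewrite lerXn2r.
by rewrite lef_pV2 ?posrE ?subr_gt0// lerD2l lerN2.
Qed.

Lemma nneseries_log u : 0 <= u < 1 ->
  (\sum_(k <oo) (u ^+ k.+1 / k.+1%:R)%:E = (- ln (1 - u))%:E)%E.
Proof.
move=> u01; have /andP[u0 u1] := u01.
apply/cvg_lim => //.
rewrite [X in X @ _ --> _](_ : _ = EFin \o (P ^~ u)); last first.
  by apply/funext => n; rewrite /= sumEFin.
apply: cvg_EFin; first exact: nearW.
have e0 : (fun n => u ^+ n.+1 / (1 - u)) @ \oo --> 0.
  rewrite -(mul0r (1 - u)^-1); apply: cvgMl.
  by rewrite (cvg_shiftS (fun n => u ^+ n)); apply: cvg_expr; rewrite ger0_norm.
have : (fun n => - ln (1 - u) - P n u) @ \oo --> 0.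
  apply: (@squeeze_cvgr _ _ _ _ (cst 0) (fun n => u ^+ n.+1 / (1 - u))) => //.
    by apply: nearW => n; exact: log_series_bounds.
  exact: cvg_cst.
move=> h.
rewrite [X in X @ _ --> _](_ : _ = (fun n => - ln (1 - u) - (- ln (1 - u) - P n u))).
  rewrite -[X in _ --> X]subr0; apply: cvgB => //; exact: cvg_cst.
by apply/funext => n /=; rewrite subKr.
Qed.

(** The sum exceeds \sum_k u^(k+1) / (k+1) = - ln (1 - u) for every u < 1. *)
Lemma nneseries_harmonic : (\sum_(k <oo) (k.+1%:R^-1 : R)%:E = +oo)%E.
Proof.
apply/eqyP => A A0.
pose u : R := 1 - expR (- A).
have u01 : 0 <= u < 1.
  rewrite subr_ge0 gtrBl expR_gt0 andbT -[leRHS]expR0 ler_expR.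
  by rewrite oppr_le0 ltW.
have -> : (A%:E = \sum_(k <oo) (u ^+ k.+1 / k.+1%:R)%:E)%E.
  by rewrite nneseries_log// /u subKr expRK opprK.
apply: lee_nneseries => k _; rewrite lee_fin.
  by rewrite divr_ge0// exprn_ge0//; case/andP: u01.
by rewrite ler_piMl// exprn_ile1 ?(ltW (proj2 (andP u01)))//; case/andP: u01.
Qed.

End logarithm.

(** * The logarithmic kernel in stereographic coordinates *)

Section stereographic.
Context {R : realType}.
Implicit Types x y : R * R.

(** Up to a factor, the inverse of the conformal factor of the stereographic
    projection. *)
Definition confN x : R := 1 + (x.1 ^+ 2 + x.2 ^+ 2).

(** In terms of the point X of the unit sphere above x, these four functions are
    (1 - X_3) / 2, (1 + X_3) / 2, X_1 / sqrt 2 and X_2 / sqrt 2, which form a unit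
    vector of R^4 whose inner products are (1 + <X, Y>) / 2. *)
Definition stereo (i : 'I_4) x : R :=
  match val i with
  | 0%N => 1
  | 1%N => x.1 ^+ 2 + x.2 ^+ 2
  | 2%N => Num.sqrt 2 * x.1
  | _ => Num.sqrt 2 * x.2
  end / confN x.

(** One minus a quarter of the squared distance of the two points above x and y on
    the unit sphere. *)
Definition chord x y : R := \sum_i stereo i x * stereo i y.

Lemma confN_ge1 x : 1 <= confN x.
Proof. by rewrite lerDl addr_ge0 ?sqr_ge0. Qed.

Lemma confN_gt0 x : 0 < confN x.
Proof. exact: lt_le_trans ltr01 (confN_ge1 x). Qed.

(** The classical formula for the chordal distance of two points of the sphere in
    terms of their stereographic projections. *)
Lemma chordE x y : (x.1 - y.1) ^+ 2 + (x.2 - y.2) ^+ 2 =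
  confN x * confN y * (1 - chord x y).
Proof.
have s2 : Num.sqrt 2 ^+ 2 = 2 :> R by rewrite sqr_sqrtr.
have nx := lt0r_neq0 (confN_gt0 x); have ny := lt0r_neq0 (confN_gt0 y).
rewrite mulrBr mulr1 /chord !big_ord_recr big_ord0 /= add0r /stereo /=.
set s := Num.sqrt 2 in s2 *.
have -> : confN x * confN y * (1 / confN x * (1 / confN y) +
   (x.1 ^+ 2 + x.2 ^+ 2) / confN x * ((y.1 ^+ 2 + y.2 ^+ 2) / confN y) +
   s * x.1 / confN x * (s * y.1 / confN y) +
   s * x.2 / confN x * (s * y.2 / confN y)) =
   1 + (x.1 ^+ 2 + x.2 ^+ 2) * (y.1 ^+ 2 + y.2 ^+ 2) +
   s ^+ 2 * (x.1 * y.1 + x.2 * y.2).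
  by field; rewrite nx ny.
by rewrite s2 /confN; ring.
Qed.

Lemma chord_le1 x y : chord x y <= 1.
Proof.
have : 0 <= confN x * confN y * (1 - chord x y) by rewrite -chordE addr_ge0 ?sqr_ge0.
by rewrite pmulr_rge0 ?subr_ge0// mulr_gt0 ?confN_gt0.
Qed.

(** N x * N y * <v x, v y> = |1 + z|^2, where z is the product of x with the
    conjugate of y as complex numbers. *)
Lemma chord_ge0 x y : 0 <= chord x y.
Proof.
have N0 : 0 < confN x * confN y by rewrite mulr_gt0 ?confN_gt0.
rewrite -(pmulr_rge0 _ N0).
have -> : confN x * confN y * chord x y = confN x * confN y -
   ((x.1 - y.1) ^+ 2 + (x.2 - y.2) ^+ 2) by rewrite chordE; ring.
rewrite [leRHS](_ : _ = (1 + x.1 * y.1 + x.2 * y.2) ^+ 2 + (x.1 * y.2 - x.2 * y.1) ^+ 2).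
  by rewrite addr_ge0 ?sqr_ge0.
by rewrite /confN; ring.
Qed.

Lemma chordxx x : chord x x = 1.
Proof.
have := chordE x x; rewrite !subrr expr0n addr0 => /esym/eqP.
rewrite mulf_eq0 (gt_eqF (mulr_gt0 (confN_gt0 x) (confN_gt0 x)))/=.
by rewrite subr_eq0 => /eqP.
Qed.

Lemma stereo_norm_le1 i x : `|stereo i x| <= 1.
Proof.
rewrite -(ler_pXn2r (ltn0Sn 1)) ?nnegrE// expr1n real_normK ?num_real//.
rewrite -(chordxx x) /chord (bigD1 i)//= expr2 lerDl sumr_ge0// => j _.
by rewrite -expr2 sqr_ge0.
Qed.

Lemma continuous_sqnorm : continuous (fun x : R * R => x.1 ^+ 2 + x.2 ^+ 2).
Proof.
move=> x; apply: cvgD; apply: cvgM; [exact: cvg_fst|exact: cvg_fst|..];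
  exact: cvg_snd.
Qed.

Lemma continuous_confN : continuous confN.
Proof. by move=> x; apply: cvgD; [exact: cvg_cst|exact: continuous_sqnorm]. Qed.

Lemma continuous_stereo i : continuous (stereo i).
Proof.
move=> x; apply: cvgM; last first.
  by apply: cvgV; [rewrite gt_eqF ?confN_gt0|exact: continuous_confN].
case: i => -[|[|[|i]]] /= _.
- exact: cvg_cst.
- exact: continuous_sqnorm.
- by apply: cvgM; [exact: cvg_cst|exact: cvg_fst].
- by apply: cvgM; [exact: cvg_cst|exact: cvg_snd].
Qed.

Definition stereo_mono k (f : {ffun 'I_k -> 'I_4}) x : R :=
  \prod_j stereo (f j) x.

(** This makes every power of the chord kernel positive definite, with an explicit
    finite family of features. *)
Lemma chord_expr k x y :
  chord x y ^+ k = \sum_(f : {ffun 'I_k -> 'I_4}) stereo_mono f x * stereo_mono f y.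
Proof.
transitivity (\prod_(j < k) chord x y); first by rewrite prodr_const card_ord.
by rewrite bigA_distr_bigA; apply: eq_bigr => f _; rewrite -big_split.
Qed.

Lemma stereo_mono_norm_le1 k (f : {ffun 'I_k -> 'I_4}) x : `|stereo_mono f x| <= 1.
Proof.
by rewrite normr_prod; apply: prodr_ile1 => i _; rewrite normr_ge0 stereo_norm_le1.
Qed.

Lemma continuous_stereo_mono k (f : {ffun 'I_k -> 'I_4}) : continuous (stereo_mono f).
Proof.
move=> x; apply: cvg_big; first exact: mul_continuous.
by move=> i _; exact: continuous_stereo.
Qed.

Lemma continuous_chord y : continuous (chord ^~ y).
Proof.
move=> x; apply: cvg_big; first exact: add_continuous.
by move=> i _; apply: cvgMl; exact: continuous_stereo.
Qed.

Definition log_series x y : \bar R :=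
  (\sum_(k <oo) (chord x y ^+ k.+1 / k.+1%:R)%:E)%E.

Definition log_confN x : R := ln (confN x).

Lemma log_confN_ge0 x : 0 <= log_confN x.
Proof. exact/ln_ge0/confN_ge1. Qed.

(** On the diagonal both sides are +oo, the series being harmonic. *)
Lemma log_kernelE x y : log_kernel x y =
  (2^-1%:E * log_series x y - (2^-1 * (log_confN x + log_confN y))%:E)%E.
Proof.
rewrite /log_kernel /enorm /=.
set r2 : R := (x.1 - y.1) ^+ 2 + (x.2 - y.2) ^+ 2.
have r2E : r2 = confN x * confN y * (1 - chord x y) by exact: chordE.
have r20 : 0 <= r2 by rewrite addr_ge0 ?sqr_ge0.
have NN0 : 0 < confN x * confN y by rewrite mulr_gt0 ?confN_gt0.
have [/eqP c1|c1] := eqVneq (chord x y) 1.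
  have -> : r2 = 0 by rewrite r2E (eqP c1) subrr mulr0.
  rewrite sqrtr0 inve0 /log_series (eqP c1).
  have -> : (\sum_(k <oo) ((1 : R) ^+ k.+1 / k.+1%:R)%:E = +oo)%E.
    rewrite -(@nneseries_harmonic R); apply: eq_eseriesr => k _.
    by rewrite expr1n mul1r.
  by rewrite gt0_muley// lte_fin invr_gt0.
have c1' : chord x y < 1 by rewrite lt_neqAle c1 chord_le1.
have c10 : 0 < 1 - chord x y by rewrite subr_gt0.
have r2_gt0 : 0 < r2 by rewrite r2E mulr_gt0.
have sr : 0 < Num.sqrt r2 by rewrite sqrtr_gt0.
rewrite /log_series nneseries_log ?chord_ge0// inver gt_eqF//.
rewrite lne_EFin ?invr_gt0// lnV ?posrE//.
rewrite -EFinM -EFinB; congr (_%:E).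
have -> : ln (Num.sqrt r2) = 2^-1 * ln r2.
  by rewrite -{2}(sqr_sqrtr r20) lnXn// -[X in _ * X]mulr_natl mulKf.
rewrite r2E !lnM ?posrE ?confN_gt0// /log_confN; ring.
Qed.

End stereographic.

(** * The energy as a series of squared moments *)

Section integral_lemmas.
Context d (T : measurableType d) (R : realType).

Lemma bounded_integrable (P : probability T R) (g : T -> R) B :
  measurable_fun setT g -> (forall x, `|g x| <= B) -> P.-integrable setT (EFin \o g).
Proof.
move=> mg gB; apply: measurable_bounded_integrable => //.
  by rewrite [X in (X < _)%E](@probability_setT _ _ _ P) ltry.
by exists B; split; [exact: num_real|move=> b Bb x _ /=; exact: le_trans (ltW Bb)].
Qed.

(** The function f may have an infinite integral, which is the case of the
    logarithmic series when the energy is infinite. *)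
Lemma ge0_integralB_integrable (mu : {measure set T -> \bar R})
    (f : T -> \bar R) (h : T -> R) :
  measurable_fun setT f -> (forall x, 0 <= f x)%E -> (forall x, 0 <= h x) ->
  mu.-integrable setT (EFin \o h) ->
  (\int[mu]_x (f x - (h x)%:E) = \int[mu]_x f x - \int[mu]_x (h x)%:E)%E.
Proof.
move=> mf f0 h0 ih.
have mh : measurable_fun setT (EFin \o h) by case/integrableP: ih.
have mfh : measurable_fun setT (fun x => f x - (h x)%:E)%E.
  by apply: emeasurable_funB.
have [foo|] := ltP (\int[mu]_x f x)%E +oo%E.
  have iff : mu.-integrable setT f.
    by apply/integrableP; split => //; under eq_integral do rewrite gee0_abs//.
  by rewrite -integralB.
rewrite leye_eq => /eqP foo; rewrite foo.
have hfin : (\int[mu]_x (h x)%:E \is a fin_num)%E by exact: integrable_fin_num.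
have -> : (+oo - \int[mu]_x (h x)%:E = +oo)%E.
  by rewrite addye//; move: hfin; rewrite -fin_numN fin_numE => /andP[].
set k := fun x => (f x - (h x)%:E)%E.
rewrite integralE.
have mpos : measurable_fun setT (k^\+)%E by exact: measurable_funepos.
have mneg : measurable_fun setT (k^\-)%E by exact: measurable_funeneg.
have negle : (\int[mu]_x (k^\- x) <= \int[mu]_x (h x)%:E)%E.
  apply: ge0_le_integral => // x _.
  rewrite funenegE ge_max lee_fin h0 andbT /k.
  by rewrite fin_num_oppeB// geeDr// oppe_le0.
have neg0 : (0 <= \int[mu]_x (k^\- x))%E by exact: integral_ge0.
have pos : (\int[mu]_x (k^\+ x) = +oo)%E.
  have : (\int[mu]_x f x <= \int[mu]_x (k^\+ x + (h x)%:E))%E.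
    apply: ge0_le_integral => //; first exact: emeasurable_funD.
    by move=> x _; rewrite funeposE -leeBlDr// le_max lexx.
  rewrite foo leye_eq ge0_integralD//; last by move=> x _; rewrite lee_fin.
  rewrite -(fineK hfin); have : (0 <= \int[mu]_x (k^\+ x))%E by exact: integral_ge0.
  by case: (\int[mu]_x _)%E.
rewrite pos addye//.
move: negle neg0; rewrite -(fineK hfin).
by case: (\int[mu]_x _)%E.
Qed.

End integral_lemmas.

Section energy_series.
Context {R : realType}.
Implicit Types (mu : probability (R * R)%type R) (x y : R * R).

Definition moment mu k (f : {ffun 'I_k -> 'I_4}) : R :=
  fine (\int[mu]_x (stereo_mono f x)%:E).

Definition moment_sqnorm mu k : R :=
  \sum_(f : {ffun 'I_k -> 'I_4}) moment mu f ^+ 2.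

Definition sqnorm x : R := x.1 ^+ 2 + x.2 ^+ 2.

(** The external field |x|^2 together with the two boundary terms - log N / 2 of the
    kernel. *)
Definition ext_field x : R := sqnorm x - log_confN x.

Definition stereo_energy mu : \bar R :=
  (\int[mu]_x (ext_field x)%:E +
   2^-1%:E * \sum_(k <oo) (moment_sqnorm mu k.+1 / k.+1%:R)%:E)%E.

Lemma sqnorm_ge0 x : 0 <= sqnorm x.
Proof. by rewrite addr_ge0 ?sqr_ge0. Qed.

Lemma log_confN_le x : log_confN x <= sqnorm x.
Proof. by apply: le_ln1Dx; exact: lt_le_trans (sqnorm_ge0 x). Qed.

Lemma ext_field_ge0 x : 0 <= ext_field x.
Proof. by rewrite subr_ge0 log_confN_le. Qed.

(** The growth of this lower bound is the source of tightness. *)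
Lemma ext_field_ge x : sqnorm x / 2 - 1 <= ext_field x.
Proof.
suff : log_confN x <= 1 + sqnorm x / 2 by rewrite /ext_field; lra.
have N0 := confN_gt0 x.
have l2 : ln 2 <= 1 :> R by apply: (@le_ln1Dx R 1); lra.
have : ln (confN x / 2) <= confN x / 2 - 1.
  have := @le_ln1Dx R (confN x / 2 - 1); rewrite addrCA subrr addr0; apply.
  by rewrite ltrBDl subrr divr_gt0.
rewrite ln_div ?posrE// /log_confN /confN -/(sqnorm x); lra.
Qed.

Lemma continuous_log_confN : continuous (@log_confN R).
Proof.
move=> x; apply: (continuous_comp (@continuous_confN R x)).
by apply: continuous_ln; exact: confN_gt0.
Qed.

Lemma continuous_ext_field : continuous ext_field.
Proof.
move=> x; apply: cvgB; first exact: continuous_sqnorm.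
exact: continuous_log_confN.
Qed.

Lemma integrable_stereo_mono mu k (f : {ffun 'I_k -> 'I_4}) :
  mu.-integrable setT (EFin \o stereo_mono f).
Proof.
apply: (@bounded_integrable _ _ _ _ _ 1); last exact: stereo_mono_norm_le1.
apply: continuous_measurable_plane; exact: continuous_stereo_mono.
Qed.

Lemma momentE mu k (f : {ffun 'I_k -> 'I_4}) :
  (\int[mu]_x (stereo_mono f x)%:E = (moment mu f)%:E)%E.
Proof. by rewrite fineK// integrable_fin_num//; exact: integrable_stereo_mono. Qed.

Lemma integral_chord_expr mu k y : (\int[mu]_x (chord x y ^+ k)%:E =
  (\sum_(f : {ffun 'I_k -> 'I_4}) moment mu f * stereo_mono f y)%:E)%E.
Proof.
under eq_integral do rewrite chord_expr -sumEFin.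
rewrite integral_sum//=; last first.
  move=> f; rewrite (_ : (fun _ => _) = (fun x => (EFin \o stereo_mono f) x * (stereo_mono f y)%:E)%E).
    by apply: integrableZr => //; exact: integrable_stereo_mono.
  by apply/funext => x; rewrite EFinM.
rewrite -sumEFin; apply: eq_bigr => f _.
under eq_integral do rewrite EFinM.
by rewrite integralZr//; [rewrite momentE EFinM|exact: integrable_stereo_mono].
Qed.

Lemma integral_chord_expr2 mu k :
  (\int[mu]_y \int[mu]_x (chord x y ^+ k)%:E = (moment_sqnorm mu k)%:E)%E.
Proof.
under eq_integral do rewrite integral_chord_expr -sumEFin.
rewrite integral_sum//=; last first.
  move=> f; rewrite (_ : (fun _ => _) = (fun x => (moment mu f)%:E * (EFin \o stereo_mono f) x)%E).
    by apply: integrableZl => //; exact: integrable_stereo_mono.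
  by apply/funext => x; rewrite EFinM.
rewrite -sumEFin; apply: eq_bigr => f _.
under eq_integral do rewrite EFinM.
by rewrite integralZl//; [rewrite momentE -EFinM expr2|exact: integrable_stereo_mono].
Qed.

Lemma measurable_chord_expr k y : measurable_fun setT (fun x => (chord x y ^+ k)%:E).
Proof.
apply/measurable_EFinP; apply: measurable_funX.
apply: continuous_measurable_plane; exact: continuous_chord.
Qed.

Let term_ge0 k x y : (0 <= (chord x y ^+ k.+1 / k.+1%:R)%:E)%E.
Proof. by rewrite lee_fin divr_ge0// exprn_ge0// chord_ge0. Qed.

Let measurable_term k y : measurable_fun setT (fun x => (chord x y ^+ k.+1 / k.+1%:R)%:E).
Proof.
under eq_fun do rewrite EFinM.
by apply: emeasurable_funM => //; exact: measurable_chord_expr.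
Qed.

Lemma log_series_ge0 x y : (0 <= log_series x y)%E.
Proof. by apply: nneseries_ge0 => k _ _. Qed.

Lemma measurable_log_series y : measurable_fun setT (log_series ^~ y).
Proof. by apply: ge0_emeasurable_sum => // k. Qed.

Definition log_potential mu y : \bar R := (\int[mu]_x log_series x y)%E.

Let int_term mu k y : (\int[mu]_x (chord x y ^+ k.+1 / k.+1%:R)%:E =
  ((\sum_(f : {ffun 'I_k.+1 -> 'I_4}) moment mu f * stereo_mono f y) / k.+1%:R)%:E)%E.
Proof.
under eq_integral do rewrite EFinM.
rewrite ge0_integralZr//; last 2 first.
- exact: measurable_chord_expr.
- by move=> x _; rewrite lee_fin exprn_ge0// chord_ge0.
by rewrite integral_chord_expr -EFinM.
Qed.

Let log_potentialE mu y : (log_potential mu y =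
  \sum_(k <oo) ((\sum_(f : {ffun 'I_k.+1 -> 'I_4}) moment mu f * stereo_mono f y) / k.+1%:R)%:E)%E.
Proof.
rewrite /log_potential /log_series integral_nneseries//.
by apply: eq_eseriesr => k _; exact: int_term.
Qed.

Let pterm_ge0 mu k y : (0 <= ((\sum_(f : {ffun 'I_k.+1 -> 'I_4}) moment mu f * stereo_mono f y) / k.+1%:R)%:E)%E.
Proof. by rewrite -int_term; exact: integral_ge0. Qed.

Let measurable_sum_moment mu k : measurable_fun setT
  (fun y => (\sum_(f : {ffun 'I_k.+1 -> 'I_4}) moment mu f * stereo_mono f y)).
Proof.
apply: measurable_sum => f; apply: measurable_funM => //.
apply: continuous_measurable_plane; exact: continuous_stereo_mono.
Qed.

Let measurable_pterm mu k : measurable_fun setT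
  (fun y => ((\sum_(f : {ffun 'I_k.+1 -> 'I_4}) moment mu f * stereo_mono f y) / k.+1%:R)%:E).
Proof. by apply/measurable_EFinP; apply: measurable_funM. Qed.

Lemma log_potential_ge0 mu y : (0 <= log_potential mu y)%E.
Proof. by apply: integral_ge0 => x _; exact: log_series_ge0. Qed.

Lemma measurable_log_potential mu : measurable_fun setT (log_potential mu).
Proof.
rewrite (funext (log_potentialE mu)).
by apply: ge0_emeasurable_sum => // k.
Qed.

Lemma integral_log_potential mu : (\int[mu]_y log_potential mu y =
  \sum_(k <oo) (moment_sqnorm mu k.+1 / k.+1%:R)%:E)%E.
Proof.
under eq_integral do rewrite log_potentialE.
rewrite integral_nneseries//; apply: eq_eseriesr => k _.
under eq_integral do rewrite EFinM.
rewrite ge0_integralZr//; last 2 first.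
- exact/measurable_EFinP.
- move=> y _; rewrite -integral_chord_expr; apply: integral_ge0 => x _.
  by rewrite lee_fin exprn_ge0// chord_ge0.
under eq_integral do rewrite -integral_chord_expr.
by rewrite integral_chord_expr2 -EFinM.
Qed.

Lemma measurable_sqnorm : measurable_fun setT (EFin \o sqnorm).
Proof. by apply/measurable_EFinP; apply: continuous_measurable_plane; exact: continuous_sqnorm. Qed.

Lemma measurable_ext_field : measurable_fun setT (EFin \o ext_field).
Proof. by apply/measurable_EFinP; apply: continuous_measurable_plane; exact: continuous_ext_field. Qed.

Lemma second_momentE mu : second_moment mu = (\int[mu]_x (sqnorm x)%:E)%E.
Proof.
by apply: eq_integral => x _; rewrite /enorm sqr_sqrtr ?sqnorm_ge0.
Qed.

(** If the second moment is infinite both sides are +oo.  Otherwise log N is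
    integrable, and the boundary terms of the kernel may be integrated apart from
    the nonnegative series, on which Tonelli's theorem acts without restriction. *)
Lemma energyE mu : energy mu = stereo_energy mu.
Proof.
rewrite /energy second_momentE /stereo_energy.
set M2 := (\int[mu]_x (sqnorm x)%:E)%E.
have M20 : (0 <= M2)%E by apply: integral_ge0 => x _; rewrite lee_fin sqnorm_ge0.
have q0 : (0 <= \int[mu]_x (ext_field x)%:E)%E.
  by apply: integral_ge0 => x _; rewrite lee_fin ext_field_ge0.
rewrite -integral_log_potential.
set T := (\int[mu]_y log_potential mu y)%E.
have T0 : (0 <= T)%E by apply: integral_ge0 => y _; exact: log_potential_ge0.
have [M2fin|] := ltP M2 +oo%E; last first.
  rewrite leye_eq => /eqP M2oo.
  have : (M2 <= \int[mu]_x (2%:E * (ext_field x)%:E + 2%:E))%E.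
    apply: ge0_le_integral => //.
    - by move=> x _; rewrite lee_fin sqnorm_ge0.
    - exact: measurable_sqnorm.
    - apply: emeasurable_funD => //; apply: emeasurable_funM => //.
      exact: measurable_ext_field.
    - move=> x _; rewrite -EFinM -EFinD lee_fin; have := ext_field_ge x; lra.
  rewrite M2oo ge0_integralD//; last 2 first.
    by move=> x _; rewrite -EFinM lee_fin mulr_ge0// ext_field_ge0.
    by apply: emeasurable_funM => //; exact: measurable_ext_field.
  rewrite integral_cst_prob ge0_integralZl_EFin//; last 2 first.
    by move=> x _; rewrite lee_fin ext_field_ge0.
    exact: measurable_ext_field.
  rewrite leye_eq => /eqP H.
  have -> : (\int[mu]_x (ext_field x)%:E = +oo)%E.
    by move: H q0; case: (\int[mu]_x _)%E.
  rewrite addye; last first.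
    by rewrite gt_eqF// (lt_le_trans (ltNyr 0))// mule_ge0.
  by case: (\int[mu]_y _)%E.
have iM2 : mu.-integrable setT (EFin \o sqnorm).
  apply/integrableP; split; first exact: measurable_sqnorm.
  by under eq_integral do rewrite gee0_abs ?lee_fin ?sqnorm_ge0//.
have mlog : measurable_fun setT (EFin \o @log_confN R).
  by apply/measurable_EFinP; apply: continuous_measurable_plane; exact: continuous_log_confN.
have ilog : mu.-integrable setT (EFin \o @log_confN R).
  apply: le_integrable iM2 => // x _ /=.
  by rewrite lee_fin !ger0_norm ?log_confN_ge0 ?sqnorm_ge0 ?log_confN_le.
pose C := fine (\int[mu]_x (log_confN x)%:E)%E.
have CE : (\int[mu]_x (log_confN x)%:E = C%:E)%E.
  by rewrite fineK// integrable_fin_num.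
have C0 : 0 <= C by apply: fine_ge0; apply: integral_ge0 => x _; rewrite lee_fin log_confN_ge0.
have half_int (c : R) : 0 <= c ->
    mu.-integrable setT (EFin \o (fun x => 2^-1 * (log_confN x + c))) /\
    (\int[mu]_x (2^-1 * (log_confN x + c))%:E = (2^-1 * (C + c))%:E)%E.
  move=> c0.
  have ic : mu.-integrable setT (cst c%:E).
    apply: (@bounded_integrable _ _ _ mu (cst c) `|c|) => //.
  have icc : mu.-integrable setT (EFin \o @log_confN R \+ cst c%:E)%E by exact: integrableD.
  rewrite (_ : (EFin \o _) = (fun x => 2^-1%:E * (EFin \o @log_confN R \+ cst c%:E) x)%E) //.
  split; first exact: integrableZl.
  under eq_integral do rewrite EFinM.
  rewrite integralZl// EFinM; congr (_ * _)%E.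
  under eq_integral do rewrite EFinD.
  by rewrite integralD// CE integral_cst_prob EFinD.
have inner y : (\int[mu]_x log_kernel x y = 2^-1%:E * log_potential mu y -
    (2^-1 * (log_confN y + C))%:E)%E.
  under eq_integral do rewrite log_kernelE.
  have [i1 i2] := half_int _ (log_confN_ge0 y).
  rewrite ge0_integralB_integrable//.
  - rewrite i2 ge0_integralZl_EFin//; first by rewrite (addrC C).
    + by move=> x _; exact: log_series_ge0.
    + exact: measurable_log_series.
  - by apply: emeasurable_funM => //; exact: measurable_log_series.
  - by move=> x; rewrite mule_ge0// ?lee_fin// log_series_ge0.
  - by move=> x; rewrite mulr_ge0// addr_ge0// log_confN_ge0.
under eq_integral do rewrite inner.
have [i1 i2] := half_int _ C0.
rewrite ge0_integralB_integrable//; last 3 first.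
- by apply: emeasurable_funM => //; exact: measurable_log_potential.
- by move=> x; rewrite mule_ge0// ?lee_fin// log_potential_ge0.
- by move=> x; rewrite mulr_ge0// addr_ge0// log_confN_ge0.
rewrite i2 ge0_integralZl_EFin//; last 2 first.
- by move=> x _; exact: log_potential_ge0.
- exact: measurable_log_potential.
have M2f : M2 \is a fin_num by rewrite ge0_fin_numE.
have -> (a b : \bar R) : b \is a fin_num -> dual_adde a b = (a + b)%E.
  by case: a b => [a| |] [b| |].
have -> : (\int[mu]_x (ext_field x)%:E = M2 - C%:E)%E.
  by rewrite -CE -integralB.
rewrite (_ : 2^-1 * (C + C) = C); last by field.
  by rewrite [LHS]addeC [LHS]addeA [LHS]addeAC.
exact: M2f.
Qed.

End energy_series.

(** * Moments determine a probability *)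

(** The polynomials (1 - t^n)^(n 2^n) converge on [0, 1] to the indicator of
    t < 1/2.  The exponent 2^n would leave a limit strictly between 0 and 1 at
    t = 1/2, which the factor n removes. *)
Section threshold.
Context {R : realType}.
Implicit Types t x w : R.

Let bernoulli_ge m x : 0 <= x -> 1 + m%:R * x <= (1 + x) ^+ m.
Proof.
move=> x0; elim: m => [|m IH]; first by rewrite mul0r addr0 expr0.
rewrite exprS; apply: (@le_trans _ _ ((1 + x) * (1 + m%:R * x))); last first.
  by rewrite ler_wpM2l// addr_ge0.
rewrite -natr1; have : 0 <= x * (m%:R * x) by rewrite !mulr_ge0.
lra.
Qed.

Let bernoulli_le m x : 0 <= x <= 1 -> 1 - m%:R * x <= (1 - x) ^+ m.
Proof.
move=> /andP[x0 x1]; elim: m => [|m IH]; first by rewrite mul0r subr0 expr0.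
rewrite exprS; apply: (@le_trans _ _ ((1 - x) * (1 - m%:R * x))); last first.
  by rewrite ler_wpM2l// subr_ge0.
rewrite -natr1; have : 0 <= x * (m%:R * x) by rewrite !mulr_ge0.
lra.
Qed.

Let cvg_natmul_expr w : 0 <= w < 1 -> (fun n => n%:R * w ^+ n) @ \oo --> 0.
Proof.
move=> /andP[w0 w1].
pose s := Num.sqrt w.
have s0 : 0 <= s by exact: sqrtr_ge0.
have sw : s ^+ 2 = w by rewrite sqr_sqrtr.
have s1 : s < 1 by rewrite -(ltr_pXn2r (ltn0Sn 1)) ?nnegrE// sw expr1n.
have s10 : 0 < 1 - s by rewrite subr_gt0.
have b n : n%:R * s ^+ n <= (1 - s)^-1.
  apply: (@le_trans _ _ (\sum_(i < n) s ^+ i)).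
    rewrite mulr_natl -[X in _ *+ X](card_ord n) -sumr_const; apply: ler_sum => i _.
    by apply: ler_wiXn2l => //; [exact: ltW|exact: ltnW (ltn_ord i)].
  rewrite -[leRHS]mul1r ler_pdivlMr// mulrC.
  rewrite -[1 - s]opprB mulNr -subrX1 opprB.
  by rewrite gerBl exprn_ge0.
apply: (@squeeze_cvgr _ _ _ _ (cst 0) (fun n => s ^+ n * (1 - s)^-1)).
- apply: nearW => n; rewrite mulr_ge0 ?exprn_ge0//= -sw exprAC expr2 mulrA mulrC.
  by rewrite ler_wpM2l ?exprn_ge0.
- exact: cvg_cst.
- rewrite -(mul0r (1 - s)^-1); apply: cvgMl.
  by apply: cvg_expr; rewrite ger0_norm.
Qed.

Lemma threshold_cvg t : 0 <= t <= 1 ->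
  (fun n => (1 - t ^+ n) ^+ (n * 2 ^ n)) @ \oo --> ((t < 2^-1)%R%:R : R).
Proof.
move=> /andP[t0 t1].
have tn n : 0 <= t ^+ n <= 1 by rewrite exprn_ge0//= exprn_ile1.
have mtn n : (n * 2 ^ n)%:R * t ^+ n = n%:R * (2 * t) ^+ n.
  by rewrite natrM natrX exprMn mulrA.
case: ltP => /= th.
  apply: (@squeeze_cvgr _ _ _ _ (fun n => 1 - n%:R * (2 * t) ^+ n) (cst 1)).
  - apply: nearW => n; rewrite -mtn bernoulli_le//=.
    by have /andP[? ?] := tn n; rewrite exprn_ile1 ?subr_ge0// gerBl.
  - rewrite -[X in _ --> X]subr0; apply: cvgB; first exact: cvg_cst.
    by apply: cvg_natmul_expr; rewrite mulr_ge0//=; lra.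
  - exact: cvg_cst.
apply: (@squeeze_cvgr _ _ _ _ (cst 0) (fun n => n.+1%:R^-1)).
- apply: nearW => n; have /andP[a b] := tn n.
  rewrite exprn_ge0 ?subr_ge0//=.
  rewrite -[leRHS]mul1r ler_pdivlMr ?ltr0n//.
  apply: (@le_trans _ _ ((1 - t ^+ n) ^+ (n * 2 ^ n) * (1 + t ^+ n) ^+ (n * 2 ^ n))).
    rewrite ler_wpM2l ?exprn_ge0 ?subr_ge0//; apply: le_trans (bernoulli_ge _ a).
    rewrite mtn -natr1 addrC lerD2l ler_peMr// exprn_ege1//; lra.
  rewrite -exprMn -subr_sqr expr1n exprn_ile1 ?subr_ge0 ?exprn_ile1 ?exprn_ge0//.
  by rewrite gerBl !exprn_ge0.
- exact: cvg_cst.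
- exact: cvg_harmonic.
Qed.

End threshold.

(** Call a bounded measurable function g a multiplier when multiplying by g
    preserves the functions h such that h v^s has the same integral for mu and nu
    for all monomials v^s.  Multipliers form an algebra closed under bounded
    pointwise limits, and it contains the coordinates of v.  The sets whose
    indicator is a multiplier hence form a sigma-algebra, which contains the
    half-planes by [threshold_cvg]. *)
Section determinacy.
Context {R : realType}.
Variables (mu nu : probability (R * R)%type R).
Hypothesis munu : forall k (f : {ffun 'I_k -> 'I_4}), moment mu f = moment nu f.
Implicit Types (g h : R * R -> R) (s : seq 'I_4).

Let bmeas g := measurable_fun setT g /\ exists B, forall x, `|g x| <= B.

Let agree g := bmeas g /\ (\int[mu]_x (g x)%:E = \int[nu]_x (g x)%:E)%E.

Let bmeas_integrable (P : probability (R * R)%type R) g :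
  bmeas g -> P.-integrable setT (EFin \o g).
Proof. by move=> [mg [B gB]]; exact: bounded_integrable gB. Qed.

Let bmeasD g h : bmeas g -> bmeas h -> bmeas (fun x => g x + h x).
Proof.
move=> [mg [B gB]] [mh [C hC]]; split; first exact: measurable_funD.
by exists (B + C) => x; rewrite (le_trans (ler_normD _ _))// lerD.
Qed.

Let bmeasM g h : bmeas g -> bmeas h -> bmeas (fun x => g x * h x).
Proof.
move=> [mg [B gB]] [mh [C hC]]; split; first exact: measurable_funM.
by exists (B * C) => x; rewrite normrM ler_pM.
Qed.

Let bmeas_cst c : bmeas (fun=> c).
Proof. by split => //; exists `|c|. Qed.

Let agreeD g h : agree g -> agree h -> agree (fun x => g x + h x).
Proof.
move=> [bg eg] [bh eh]; split; first exact: bmeasD.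
under eq_integral do rewrite EFinD.
under [RHS]eq_integral do rewrite EFinD.
by rewrite !integralD//; [rewrite eg eh|exact: bmeas_integrable..].
Qed.

Let agreeZ c g : agree g -> agree (fun x => c * g x).
Proof.
move=> [bg eg]; split; first by apply: bmeasM => //; exact: bmeas_cst.
under eq_integral do rewrite EFinM.
under [RHS]eq_integral do rewrite EFinM.
by rewrite !integralZl//; [rewrite eg|exact: bmeas_integrable..].
Qed.

Let bmeas_lim (g_ : nat -> R * R -> R) g B : (forall n, bmeas (g_ n)) ->
  (forall n x, `|g_ n x| <= B) -> (forall x, g_ n x @[n --> \oo] --> g x) -> bmeas g.
Proof.
move=> mg gB gg; split.
  by apply: (measurable_fun_cvg (h := g_)) => // n; case: (mg n).
exists B => x.
apply: (@closed_cvg _ _ \oo _ (fun n => `|g_ n x|) (fun y => y <= B)).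
- exact: closed_le.
- exact: nearW.
- exact: cvg_norm.
Qed.

Let agree_lim (g_ : nat -> R * R -> R) g B : (forall n, agree (g_ n)) ->
  (forall n x, `|g_ n x| <= B) -> (forall x, g_ n x @[n --> \oo] --> g x) -> agree g.
Proof.
move=> ag gB gg.
have bg : bmeas g by apply: bmeas_lim gg => // n; case: (ag n).
split => //.
have B0 : 0 <= B by apply: le_trans (gB 0%N point).
have cv (P : probability (R * R)%type R) :
    (\int[P]_x (g_ n x)%:E @[n --> \oo] --> \int[P]_x (g x)%:E)%E.
  apply: (@dominated_cvg _ _ _ P setT _ _ _ (cst B%:E)) => //.
  - by move=> n; apply/measurable_EFinP; case: (ag n) => -[].
  - by move=> x _; apply: cvg_EFin; [exact: nearW|exact: gg].
  - by apply: (bmeas_integrable P (bmeas_cst B)).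
  - by move=> n x _; rewrite lee_fin.
apply: cvg_unique (cv nu) => //.
rewrite (_ : (fun n => _) = (fun n => \int[mu]_x (g_ n x)%:E)%E); first exact: cv.
by apply/funext => n; case: (ag n) => _ ->.
Qed.

Let mono s (x : R * R) : R := \prod_(i <- s) stereo i x.

Let bmeas_stereo i : bmeas (stereo i).
Proof.
split; last by exists 1 => x; exact: stereo_norm_le1.
apply: continuous_measurable_plane; exact: continuous_stereo.
Qed.

Let agree_mono s : agree (mono s).
Proof.
have E : mono s = stereo_mono [ffun j : 'I_(size s) => nth ord0 s j].
  apply/funext => x; rewrite /mono /stereo_mono (big_nth ord0) big_mkord.
  by apply: eq_bigr => j _; rewrite ffunE.
rewrite E; split; last by rewrite !momentE munu.
split; last by exists 1 => x; exact: stereo_mono_norm_le1.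
apply: continuous_measurable_plane; exact: continuous_stereo_mono.
Qed.

Let stable h := forall s, agree (fun x => h x * mono s x).

Let multiplier g := bmeas g /\ forall h, stable h -> stable (fun x => g x * h x).

Let eq_agree g h : (forall x, g x = h x) -> agree g -> agree h.
Proof. by move=> /funext ->. Qed.

Let multiplierD g h : multiplier g -> multiplier h -> multiplier (fun x => g x + h x).
Proof.
move=> [bg mg] [bh mh]; split; first exact: bmeasD.
move=> k ks s; apply: eq_agree (agreeD (mg _ ks s) (mh _ ks s)) => x.
by rewrite !mulrDl.
Qed.

Let multiplierM g h : multiplier g -> multiplier h -> multiplier (fun x => g x * h x).
Proof.
move=> [bg mg] [bh mh]; split; first exact: bmeasM.
move=> k ks s; apply: eq_agree (mg _ (mh _ ks) s) => x.
by rewrite !mulrA.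
Qed.

Let multiplier_cst c : multiplier (fun=> c).
Proof.
split; first exact: bmeas_cst.
move=> k ks s; apply: eq_agree (agreeZ c (ks s)) => x.
by rewrite !mulrA.
Qed.

Let multiplier_stereo i : multiplier (stereo i).
Proof.
split; first exact: bmeas_stereo.
move=> k ks s; apply: eq_agree (ks (i :: s)) => x.
by rewrite /mono big_cons mulrCA mulrA.
Qed.

Let multiplierX g n : multiplier g -> multiplier (fun x => g x ^+ n).
Proof.
move=> mg; elim: n => [|n IH].
  by rewrite (_ : (fun x => g x ^+ 0) = fun=> 1)//; exact: multiplier_cst.
rewrite (_ : (fun x => g x ^+ n.+1) = fun x => g x * g x ^+ n); first exact: multiplierM.
by apply/funext => x; rewrite exprS.
Qed.

Let multiplier_lim (g_ : nat -> R * R -> R) g : (forall n, multiplier (g_ n)) ->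
  (forall n x, 0 <= g_ n x <= 1) -> (forall x, g_ n x @[n --> \oo] --> g x) -> multiplier g.
Proof.
move=> mg gB gg.
have gB1 n x : `|g_ n x| <= 1 by have /andP[? ?] := gB n x; rewrite ger0_norm.
split; first by apply: bmeas_lim gg => // n; case: (mg n).
move=> k ks s.
have [[_ [C kC]] _] := ks s.
apply: (@agree_lim (fun n x => g_ n x * k x * mono s x) _ C).
- by move=> n; have [_ /(_ k ks s)] := mg n.
- move=> n x; rewrite -mulrA normrM -[leRHS]mul1r ler_pM//.
- by move=> x; apply: cvgMl; apply: cvgMl.
Qed.

Let good (E : set (R * R)) := multiplier (\1_E : R * R -> R).

Let goodC E : good E -> good (~` E).
Proof.
move=> gE; rewrite /good (_ : \1__ = fun x => 1 + -1 * \1_E x).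
  by apply: multiplierD; [exact: multiplier_cst|apply: multiplierM => //; exact: multiplier_cst].
by apply/funext => x; rewrite !indicE in_setC; case: (x \in E) => /=; ring.
Qed.

Let goodI E F : good E -> good F -> good (E `&` F).
Proof.
move=> gE gF; rewrite /good (_ : \1__ = fun x => \1_E x * \1_F x).
  exact: multiplierM.
by apply/funext => x; rewrite !indicE in_setI -natrM mulnb.
Qed.

Let good0 : good set0.
Proof.
by rewrite /good indic0; exact: multiplier_cst.
Qed.

Let good_bigcup (F : (set (R * R))^nat) : (forall n, good (F n)) -> good (\bigcup_n F n).
Proof.
move=> gF; apply: (@multiplier_lim (fun n => \1_(\big[setU/set0]_(k < n) F k))).
- move=> n; rewrite -/(good _); elim: n => [|n IH]; first by rewrite big_ord0.
  rewrite big_ord_recr/= -[_ `|` _]setCK setCU; apply: goodC.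
  by apply: goodI; exact: goodC.
- by move=> n x; rewrite indicE; case: (_ \in _); rewrite /= ?lexx ?ler01.
- move=> x; apply: cvg_near_cst.
  have [[k _ Fkx]|nF] := pselect ((\bigcup_n F n) x).
    exists k.+1 => // n /= kn.
    have Fn : (\big[setU/set0]_(j < n) F j) x by rewrite -bigcup_mkord; exists k.
    by rewrite !indicE (mem_set Fn) mem_set//; exists k.
  apply: nearW => n.
  have Fn : ~ (\big[setU/set0]_(j < n) F j) x.
    by rewrite -bigcup_mkord => -[k _ ?]; apply: nF; exists k.
  by rewrite !indicE (memNset Fn) (memNset nF).
Qed.

Let good_lt g : multiplier g -> (forall x, 0 <= g x <= 1) ->
  good [set x | g x < 2^-1].
Proof.
move=> mg g01.
apply: (@multiplier_lim (fun n x => (1 + -1 * g x ^+ n) ^+ (n * 2 ^ n))).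
- move=> n; apply: multiplierX; apply: multiplierD; first exact: multiplier_cst.
  by apply: multiplierM; [exact: multiplier_cst|exact: multiplierX].
- move=> n x; have /andP[a b] := g01 x; rewrite mulN1r.
  have h : 0 <= g x ^+ n <= 1 by rewrite exprn_ge0//= exprn_ile1.
  by have /andP[? ?] := h; rewrite exprn_ge0 ?exprn_ile1 ?subr_ge0// gerBl.
- move=> x; rewrite indicE [X in (nat_of_bool X)%:R](_ : _ = (g x < 2^-1)%R); last first.
    by apply/idP/idP => [/set_mem//|?]; apply: mem_set.
  by under eq_fun do rewrite mulN1r; exact: threshold_cvg.
Qed.

(** The linear form w = sqrt 2 (p - a) / N in v has the sign of p - a, and an affine
    change of variable takes its range into [0, 1] and its zero to 1/2. *)
Let good_coord (p : R * R -> R) (i : 'I_4) (a : R) :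
  (forall x, stereo i x = Num.sqrt 2 * p x / confN x) -> good [set x | p x < a].
Proof.
move=> pi.
have s20 : 0 < Num.sqrt 2 :> R by rewrite sqrtr_gt0.
set s2 := Num.sqrt 2 in pi s20.
pose K : R := 1 + `|s2 * a|.
have K0 : 0 < K by rewrite ltr_pwDl.
pose w x := stereo i x + - (s2 * a) * stereo ord0 x.
have wE x : w x = s2 * (p x - a) / confN x.
  rewrite /w pi /stereo /=; ring.
pose t x := 2^-1 + (2 * K)^-1 * w x.
have tw x : t x = (1 + w x / K) / 2.
  by rewrite /t; field; rewrite gt_eqF.
have -> : [set x | p x < a] = [set x | t x < 2^-1].
  apply/seteqP; split=> x /=.
    move=> pa; rewrite /t gtrDl pmulr_rlt0 ?invr_gt0 ?mulr_gt0//.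
    by rewrite wE pmulr_llt0 ?invr_gt0 ?confN_gt0// pmulr_rlt0// subr_lt0.
  rewrite /t gtrDl pmulr_rlt0 ?invr_gt0 ?mulr_gt0//.
  by rewrite wE pmulr_llt0 ?invr_gt0 ?confN_gt0// pmulr_rlt0// subr_lt0.
apply: good_lt.
  apply: multiplierD; first exact: multiplier_cst.
  apply: multiplierM; first exact: multiplier_cst.
  apply: multiplierD; first exact: multiplier_stereo.
  by apply: multiplierM; [exact: multiplier_cst|exact: multiplier_stereo].
move=> x; have wK : `|w x / K| <= 1.
  rewrite normrM normfV (gtr0_norm K0) ler_pdivrMr// mul1r.
  rewrite (le_trans (ler_normD _ _))// lerD ?stereo_norm_le1//.
  by rewrite normrM normrN ler_piMr// stereo_norm_le1.
by move: wK; rewrite ler_norml tw => /andP[? ?]; apply/andP; split; lra.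
Qed.

Let good_preimage (p : R * R -> R) : (forall a, good [set x | p x < a]) ->
  preimage_set_system setT p measurable `<=` good.
Proof.
move=> gp _ [B mB <-]; rewrite setTI.
have {mB} : (@RGenInftyO.G R).-sigma.-measurable B by rewrite -RGenInftyO.measurableE.
move: B; apply: smallest_sub.
  split => /=.
  - by rewrite preimage_set0; exact: good0.
  - by move=> A cA; rewrite setTD preimage_setC; exact: goodC.
  - by move=> F cF; rewrite preimage_bigcup; exact: good_bigcup.
move=> _ [c ->]; rewrite [X in good X](_ : _ = [set x | p x < c]); first exact: gp.
by apply/seteqP; split=> x /=; rewrite in_itv.
Qed.

Let good_measurable E : measurable E -> good E.
Proof.
move: E; apply: smallest_sub.
  split; first exact: good0.
  - by move=> A gA; rewrite setTD; exact: goodC.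
  - exact: good_bigcup.
rewrite subUset; split; apply: good_preimage => a.
- exact: (@good_coord _ (@Ordinal 4 2 isT)).
- exact: (@good_coord _ (@Ordinal 4 3 isT)).
Qed.

Lemma moment_determinacy : same_measure mu nu.
Proof.
move=> A mA.
have [_ gA] := good_measurable mA.
have st1 : stable (fun=> 1).
  by move=> s; apply: eq_agree (agree_mono s) => x; rewrite mul1r.
have [_] := gA _ st1 [::].
rewrite (_ : (fun x => (_ * _ * mono [::] x)%:E) = EFin \o \1_A).
  by rewrite !integral_indic// !setIT.
by apply/funext => x /=; rewrite /mono big_nil !mulr1.
Qed.

End determinacy.

(** * Strict convexity of the energy *)

Section midpoint.
Context d (T : measurableType d) (R : realType).
Variables mu nu : probability T R.

Definition midpoint : set T -> \bar R :=
  measure_add (mscale (2^-1)%:nng mu) (mscale (2^-1)%:nng nu).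

HB.instance Definition _ := Measure.on midpoint.

Lemma midpointE A : (midpoint A = 2^-1%:E * mu A + 2^-1%:E * nu A)%E.
Proof. by rewrite /midpoint measure_addE. Qed.

Let midpoint_setT : midpoint setT = 1%E.
Proof.
rewrite midpointE [X in (_ * X + _)%E](@probability_setT _ _ _ mu).
rewrite [X in (_ + _ * X)%E](@probability_setT _ _ _ nu) !mule1 -EFinD.
by congr (_%:E); field.
Qed.

HB.instance Definition _ := Measure_isProbability.Build _ _ _ midpoint midpoint_setT.

Lemma ge0_integral_midpoint (f : T -> \bar R) :
  measurable_fun setT f -> (forall x, 0 <= f x)%E ->
  (\int[midpoint]_x f x =
   2^-1%:E * \int[mu]_x f x + 2^-1%:E * \int[nu]_x f x)%E.
Proof.
by move=> mf f0; rewrite ge0_integral_measure_add// !ge0_integral_mscale.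
Qed.

End midpoint.

Section strict_convexity.
Context {R : realType}.
Variables mu nu : probability (R * R)%type R.
Let mid : probability (R * R)%type R := midpoint mu nu.

(** Adding 1 makes the integrand nonnegative, for which integrals against sums of
    measures are additive. *)
Lemma moment_midpoint k (f : {ffun 'I_k -> 'I_4}) :
  moment mid f = (moment mu f + moment nu f) / 2.
Proof.
have int1 (P : probability (R * R)%type R) :
    (\int[P]_x (stereo_mono f x + 1)%:E = (moment P f + 1)%:E)%E.
  under eq_integral do rewrite EFinD.
  rewrite integralD//; [by rewrite momentE integral_cst_prob|..].
    exact: integrable_stereo_mono.
  exact: (@bounded_integrable _ _ _ P (cst 1) `|1|).
have := int1 mid; rewrite /mid ge0_integral_midpoint; last 2 first.
- apply/measurable_EFinP; apply: measurable_funD => //.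
  apply: continuous_measurable_plane; exact: continuous_stereo_mono.
- move=> x; rewrite lee_fin -lerBlDr sub0r.
  by have := stereo_mono_norm_le1 f x; rewrite ler_norml => /andP[].
rewrite !int1 -!EFinM -EFinD => -[]; rewrite -/mid; lra.
Qed.

Definition moment_gap k : R :=
  \sum_(f : {ffun 'I_k -> 'I_4}) (moment mu f - moment nu f) ^+ 2.

Lemma moment_sqnorm_parallelogram k :
  moment_sqnorm mid k + moment_gap k / 4 =
  (moment_sqnorm mu k + moment_sqnorm nu k) / 2.
Proof.
rewrite /moment_sqnorm /moment_gap -big_split !mulr_suml -big_split/=.
by apply: eq_bigr => f _; rewrite moment_midpoint; field.
Qed.

Lemma moment_sqnorm_ge0 (P : probability (R * R)%type R) k : 0 <= moment_sqnorm P k.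
Proof. by apply: sumr_ge0 => f _; exact: sqr_ge0. Qed.

Lemma moment_gap_ge0 k : 0 <= moment_gap k.
Proof. by apply: sumr_ge0 => f _; exact: sqr_ge0. Qed.

Lemma stereo_energy_midpoint :
  (stereo_energy mid + 8^-1%:E * \sum_(k <oo) (moment_gap k.+1 / k.+1%:R)%:E =
   2^-1%:E * stereo_energy mu + 2^-1%:E * stereo_energy nu)%E.
Proof.
have q0 (P : probability (R * R)%type R) : (0 <= \int[P]_x (ext_field x)%:E)%E.
  by apply: integral_ge0 => x _; rewrite lee_fin ext_field_ge0.
have t0 (P : probability (R * R)%type R) k : (0 <= (moment_sqnorm P k.+1 / k.+1%:R)%:E)%E.
  by rewrite lee_fin divr_ge0// moment_sqnorm_ge0.
have s0 (P : probability (R * R)%type R) :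
    (0 <= \sum_(k <oo) (moment_sqnorm P k.+1 / k.+1%:R)%:E)%E.
  by apply: nneseries_ge0.
have g0 k : (0 <= (moment_gap k.+1 / k.+1%:R)%:E)%E.
  by rewrite lee_fin divr_ge0// moment_gap_ge0.
have h0 : (0 <= 2^-1%:E :> \bar R)%E by rewrite lee_fin.
rewrite /stereo_energy /mid ge0_integral_midpoint; last 2 first.
- exact: measurable_ext_field.
- by move=> x; rewrite lee_fin ext_field_ge0.
rewrite -/mid.
rewrite !(ge0_muleDr _ (q0 _)) ?mule_ge0// -addeA [RHS]addeACA; congr (_ + _)%E.
have -> : (8^-1%:E = 2^-1%:E * 4^-1%:E :> \bar R)%E.
  by rewrite -EFinM; congr (_%:E); field.
rewrite -muleA -!ge0_muleDr ?mule_ge0//; last exact: nneseries_ge0.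
congr (_ * _)%E.
rewrite -nneseriesZl// -!nneseriesD//; last by move=> k _ _; rewrite mule_ge0.
rewrite -nneseriesZl//; last by move=> k _; rewrite adde_ge0.
apply: eq_eseriesr => k _; rewrite /= -?EFinD -!EFinM -?EFinD; congr (_%:E).
have := moment_sqnorm_parallelogram k.+1.
set a := moment_sqnorm mid _; set b := moment_sqnorm mu _; set c := moment_sqnorm nu _.
rewrite -mulrDl !mulrA [2^-1 * _]mulrC => <-; ring.
Qed.

Lemma moment_gap0_same : (forall k, moment_gap k.+1 = 0) -> same_measure mu nu.
Proof.
move=> gap0; apply: moment_determinacy => -[f|k f].
  rewrite /moment.
  have E : stereo_mono f = (fun=> 1) :> (R * R -> R).
    by apply/funext => x; rewrite /stereo_mono big_ord0.
  by rewrite E !integral_cst_prob.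
have /eqP := gap0 k; rewrite psumr_eq0; last by move=> g _; exact: sqr_ge0.
by move=> /allP/(_ f (mem_index_enum _)); rewrite /= sqrf_eq0 subr_eq0 => /eqP.
Qed.

(** The finiteness of e is essential: the gap is read off by cancelling e. *)
Lemma stereo_energy_midpoint_min (e : R) :
  stereo_energy mu = e%:E -> stereo_energy nu = e%:E ->
  (e%:E <= stereo_energy mid)%E -> same_measure mu nu.
Proof.
move=> emu enu emid; apply: moment_gap0_same => k.
have := stereo_energy_midpoint; rewrite emu enu -EFinM -EFinD.
rewrite (_ : 2^-1 * e + 2^-1 * e = e); last by field.
set S := (\sum_(k <oo) (moment_gap k.+1 / k.+1%:R)%:E)%E => H.
have g0 j : (0 <= (moment_gap j.+1 / j.+1%:R)%:E)%E.
  by rewrite lee_fin divr_ge0// moment_gap_ge0.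
have S0 : (0 <= S)%E by exact: nneseries_ge0.
have cancel (m s : \bar R) : (e%:E <= m -> 0 <= s -> m + 8^-1%:E * s = e%:E -> s = 0)%E.
  case: m s => [m| |] [s| |]//=; last 2 first.
  - by rewrite gt0_muley// lte_fin invr_gt0.
  - by rewrite gt0_muley// lte_fin invr_gt0.
  by rewrite !lee_fin -EFinM -EFinD => em s0 [H2]; congr (_%:E); lra.
have S00 := cancel _ _ emid S0 H.
have : (\sum_(0 <= j < k.+1) (moment_gap j.+1 / j.+1%:R)%:E <= S)%E.
  by apply: nneseries_lim_ge.
rewrite S00 big_nat_recr//= => h.
have {h} : ((moment_gap k.+1 / k.+1%:R)%:E <= 0)%E.
  by apply: le_trans h; rewrite leeDr// sume_ge0.
rewrite lee_fin pmulr_lle0 ?invr_gt0// => h.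
by apply/eqP; rewrite eq_le h moment_gap_ge0.
Qed.

End strict_convexity.

(** * Curves parametrized by arc length *)

Section arc_length_curve.
Context {R : realType} (G : R -> R * R).
Hypothesis hG : arc_length_parametrization G.
Implicit Types s t : R.

Lemma is_derive_fst t : is_derive t 1 (fun s => (G s).1) (derive1 G t).1.
Proof.
have [dG _] := hG t; rewrite derive1E.
have h : h^-1 *: ((G \o shift t) (h *: 1) - G t) @[h --> 0^'] --> 'D_1 G t by exact: dG.
have h1 : h^-1 *: (((fun s => (G s).1) \o shift t) (h *: 1) - (G t).1) @[h --> 0^']
    --> ('D_1 G t).1.
  apply: (cvg_comp (fun h => h^-1 *: ((G \o shift t) (h *: 1) - G t)) fst h).
  exact: cvg_fst.
by split; [apply/cvg_ex; exists ('D_1 G t).1|exact/cvg_lim].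
Qed.

Lemma is_derive_snd t : is_derive t 1 (fun s => (G s).2) (derive1 G t).2.
Proof.
have [dG _] := hG t; rewrite derive1E.
have h : h^-1 *: ((G \o shift t) (h *: 1) - G t) @[h --> 0^'] --> 'D_1 G t by exact: dG.
have h1 : h^-1 *: (((fun s => (G s).2) \o shift t) (h *: 1) - (G t).2) @[h --> 0^']
    --> ('D_1 G t).2.
  apply: (cvg_comp (fun h => h^-1 *: ((G \o shift t) (h *: 1) - G t)) snd h).
  exact: cvg_snd.
by split; [apply/cvg_ex; exists ('D_1 G t).2|exact/cvg_lim].
Qed.

Let is_derive_continuous (f df : R -> R) :
  (forall t, is_derive t 1 f (df t)) -> continuous f.
Proof.
by move=> d t; apply: differentiable_continuous; apply/derivable1_diffP; case: (d t).
Qed.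

Let is_derive_MVT (f df : R -> R) s t : (forall t, is_derive t 1 f (df t)) -> s <= t ->
  exists2 c, s <= c <= t & f t - f s = df c * (t - s).
Proof.
move=> d st.
have [|c cst e] := @MVT_segment R f df s t st (fun x _ => d x).
- by apply: continuous_subspaceT => x; exact: is_derive_continuous d x.
- by exists c => //; move: cst; rewrite in_itv.
Qed.

Let is_derive_lipschitz (f df : R -> R) s t :
  (forall t, is_derive t 1 f (df t)) -> (forall t, `|df t| <= 1) ->
  `|f s - f t| <= `|s - t|.
Proof.
move=> d b; wlog st : s t / s <= t.
  by move=> W; have [/W//|/ltW/W] := leP s t; rewrite distrC (distrC t).
have [c _ e] := is_derive_MVT d st.
by rewrite distrC e distrC normrM ler_piMl.
Qed.

Let tangent_sqr t : (derive1 G t).1 ^+ 2 + (derive1 G t).2 ^+ 2 = 1.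
Proof.
have [_] := hG t; rewrite /enorm => e.
by rewrite -[LHS]sqr_sqrtr ?addr_ge0 ?sqr_ge0// e expr1n.
Qed.

Let sqr_le1 (z : R) : z ^+ 2 <= 1 -> `|z| <= 1.
Proof.
by move=> z1; rewrite -(ler_pXn2r (ltn0Sn 1)) ?nnegrE// real_normK ?num_real// expr1n.
Qed.

Lemma curve_fst_lipschitz s t : `|(G s).1 - (G t).1| <= `|s - t|.
Proof.
apply: (is_derive_lipschitz (f := fun s => (G s).1) _ _ is_derive_fst) => u.
by apply: sqr_le1; rewrite -(tangent_sqr u) lerDl sqr_ge0.
Qed.

Lemma curve_snd_lipschitz s t : `|(G s).2 - (G t).2| <= `|s - t|.
Proof.
apply: (is_derive_lipschitz (f := fun s => (G s).2) _ _ is_derive_snd) => u.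
by apply: sqr_le1; rewrite -(tangent_sqr u) lerDr sqr_ge0.
Qed.

Lemma continuous_curve : continuous G.
Proof.
by move=> t; apply: differentiable_continuous; apply/derivable1_diffP; case: (hG t).
Qed.

Lemma measurable_curve : measurable_fun setT G.
Proof.
apply/measurable_fun_pairP; split; apply: continuous_measurable_fun.
  exact: is_derive_continuous is_derive_fst.
exact: is_derive_continuous is_derive_snd.
Qed.

(** The curve is then the image of one period, which is compact. *)
Lemma closed_periodic_range (L : R) : 0 < L -> (forall t, G (t + L) = G t) ->
  closed (range G).
Proof.
move=> L0 per.
have perN (n : nat) t : G (t + n%:R * L) = G t.
  elim: n => [|n IH]; first by rewrite mul0r addr0.
  by rewrite -natr1 mulrDl mul1r addrA per.
have -> : range G = G @` `[0, L]%classic.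
  apply/seteqP; split=> [_ [t _ <-]|_ [t _ <-]]; last by exists t.
  pose k := Num.floor (t / L).
  have : k%:~R <= t / L < (k + 1)%:~R by rewrite floor_le_tmp floorD1_gt.
  rewrite ler_pdivlMr// ltr_pdivrMr// intrD mulrDl mul1r => /andP[kt tk].
  exists (t - k%:~R * L).
    by rewrite /= in_itv/= subr_ge0 kt lerBlDr addrC ltW.
  case: (k) => n.
    by rewrite -[in RHS](subrK (n%:R * L) t) perN.
  by rewrite NegzE mulrNz mulNr opprK perN.
apply: compact_closed; first exact: norm_hausdorff.
apply: continuous_compact; last exact: segment_compact.
by apply: continuous_subspaceT => x; exact: continuous_curve.
Qed.

(** Let K be a square around y.  As G^-1 K has finite length, its part outside of
    [-n, n] is shorter than 1 for some n.  Since G is 1-Lipschitz, a parameter t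
    with G t close to y comes with the whole interval [t - 1, t + 1] in G^-1 K, so
    that |t| <= n + 1: near y the curve is a compact arc. *)
Lemma closed_proper_range :
  (forall K : set (R * R), compact K ->
    (lebesgue_measure (G @^-1` K) < +oo)%E) -> closed (range G).
Proof.
move=> fin y cy.
pose K : set (R * R) := `[y.1 - 2, y.1 + 2]%classic `*` `[y.2 - 2, y.2 + 2]%classic.
have cK : compact K by apply: compact_setX; exact: segment_compact.
pose T := G @^-1` K.
have mT : measurable T.
  rewrite -[T]setTI; apply: measurable_curve => //.
  by apply: measurableX; exact: measurable_itv.
pose F n := T `&` [set t | n%:R < `|t|].
have mF n : measurable (F n).
  apply: measurableI => //; apply: open_measurable.
  apply: (@open_comp _ _ (fun x : R => `|x|) [set x | n%:R < x]); last exact: open_gt.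
  by move=> x _; exact: norm_continuous.
have F0 : lebesgue_measure (F n) @[n --> \oo] --> (0 : \bar R)%E.
  rewrite -(measure0 (@lebesgue_measure R)).
  rewrite [X in _ --> _ X](_ : _ = \bigcap_n F n); last first.
    apply/seteqP; split => // t h; have [_ /=] := h (Num.trunc `|t|).+1 I.
    by rewrite ltNge ltW// truncnS_gt.
  apply: nonincreasing_cvg_mu => //.
  - apply: le_lt_trans (fin _ cK); apply: le_measure; rewrite ?inE //; first exact: mF.
    by move=> t [].
  - by apply: bigcapT_measurable => k; exact: mF.
  - move=> m n mn; apply/subsetPset; apply: setIS => t /=.
    by apply: le_lt_trans; rewrite ler_nat.
have [n Fn] : exists n, (lebesgue_measure (F n) < 1)%E.
  have /fine_cvgP[[N1 _ fN] /cvgrPdist_lt /(_ 1 ltr01)[N2 _ H]] := F0.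
  exists (maxn N1 N2); have := H (maxn N1 N2) (leq_maxr _ _).
  rewrite /= sub0r normrN => /(le_lt_trans (ler_norm _)).
  by rewrite -lte_fin fineK//; exact: (fN _ (leq_maxl _ _)).
have Pn t : `|y.1 - (G t).1| < 1 -> `|y.2 - (G t).2| < 1 -> `|t| <= n.+1%:R.
  move=> y1 y2; rewrite leNgt; apply/negP => nt.
  suff : (2%:E <= lebesgue_measure (F n))%E.
    by apply/negP; rewrite -ltNge (lt_trans Fn)// lte_fin ltr1n.
  have -> : 2%:E = lebesgue_measure `[t - 1, t + 1]%classic :> \bar R.
    rewrite lebesgue_measure_itv /= lte_fin ltrD2l gtrN//.
    by rewrite -EFinB; congr (_%:E); ring.
  apply: le_measure; [by rewrite inE; exact: measurable_itv|by rewrite inE; exact: mF|].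
  move=> u /=; rewrite in_itv/= => /andP[u1 u2].
  have ut : `|u - t| <= 1 by rewrite ler_distlC; apply/andP; split; lra.
  split.
    have l1 := le_trans (curve_fst_lipschitz u t) ut.
    have l2 := le_trans (curve_snd_lipschitz u t) ut.
    move: y1 y2 l1 l2; rewrite !ler_norml !ltr_norml => /andP[? ?] /andP[? ?] /andP[? ?] /andP[? ?].
    by split; rewrite /= in_itv/=; apply/andP; split; lra.
  rewrite /=; have : `|t| <= `|u| + `|u - t|.
    by rewrite -{1}(subKr u t) (le_trans (ler_normB _ _)).
  by move: nt; rewrite -natr1; lra.
pose C := G @` `[- n.+1%:R, n.+1%:R]%classic.
have cC : closed C.
  apply: compact_closed; first exact: norm_hausdorff.
  apply: continuous_compact; last exact: segment_compact.
  by apply: continuous_subspaceT => x; exact: continuous_curve.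
suff : C y by move=> [t _ <-]; exists t.
apply: contrapT => nCy.
have : nbhs y (ball y 1 `&` ~` C).
  apply: filterI; first exact: nbhsx_ballx.
  by apply: open_nbhs_nbhs; split => //; exact: closed_openC.
move=> /cy[_ [[t _ <-] [[/= b1 b2] nC]]].
apply: nC; exists t => //=; rewrite in_itv/= -ler_norml.
exact: Pn.
Qed.

Lemma closed_curve_range : locally_finite_length G -> no_self_intersections G ->
  closed (range G).
Proof.
move=> hlen [J hJ]; have [_ [JT|[L [L0 per _]]]] := hJ.
  apply: closed_proper_range => K cK.
  by have := hlen J hJ K cK; rewrite JT setTI.
exact: closed_periodic_range per.
Qed.

End arc_length_curve.

(** * Probabilities with linear growth have finite energy *)

Section frostman.
Context {R : realType}.
Implicit Types (x y : R * R) (mu : probability (R * R)%type R).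

Definition eball y (r : R) : set (R * R) := [set x | enorm (x - y) <= r].

Let enorm_sqr x y : enorm (x - y) ^+ 2 = confN x * confN y * (1 - chord x y).
Proof. by rewrite -chordE /enorm sqr_sqrtr// addr_ge0 ?sqr_ge0. Qed.

Lemma measurable_eball y r : measurable (eball y r).
Proof.
have : measurable_fun setT (fun x => enorm (x - y)).
  apply: (measurableT_comp (f := @Num.sqrt R)).
    apply: continuous_measurable_fun; exact: sqrt_continuous.
  apply: continuous_measurable_plane => x.
  by apply: cvgD; apply: cvgM; apply: cvgB; [exact: cvg_fst|exact: cvg_cst|exact: cvg_fst|exact: cvg_cst
    |exact: cvg_snd|exact: cvg_cst|exact: cvg_snd|exact: cvg_cst].
move=> /(_ measurableT `]-oo, r]%classic (measurable_itv _)).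
by rewrite setTI (_ : _ @^-1` _ = eball y r)//; apply/seteqP; split=> x /=; rewrite in_itv.
Qed.

Let indic_ge0 j x y : (0 <= (\1_(eball y (2 ^- j)) x : R)%:E)%E.
Proof. by rewrite lee_fin indicE. Qed.

(** The logarithm of 1 / r is at most the number of the j such that r <= 2^-j, so
    that the integral of the kernel is controlled by the masses of discs. *)
Lemma log_series_le x y : (log_series x y <= (log_confN x + log_confN y)%:E +
  2%:E * \sum_(j <oo) (\1_(eball y (2 ^- j)) x)%:E)%E.
Proof.
set r := enorm (x - y).
have r0 : 0 <= r by exact: sqrtr_ge0.
have cc0 : 0 <= log_confN x + log_confN y by rewrite addr_ge0 ?log_confN_ge0.
have [rz|rnz] := eqVneq r 0.
  have -> : (\sum_(j <oo) (\1_(eball y (2 ^- j)) x : R)%:E = +oo)%E.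
    apply/eqyP => A A0.
    apply: (@le_trans _ _ (\sum_(0 <= j < (Num.trunc A).+1) (\1_(eball y (2 ^- j)) x : R)%:E)%E).
      rewrite sumEFin lee_fin.
      under eq_bigr => j _.
        rewrite indicE mem_set; last by rewrite /eball /= -/r rz invr_ge0 exprn_ge0.
        over.
      by rewrite big_const_nat subn0 iter_addr_0 ltW// truncnS_gt.
    by apply: nneseries_lim_ge => j _ _.
  by rewrite gt0_muley ?lte_fin// addey// leey.
have rp : 0 < r by rewrite lt_def rnz.
have u1 : 0 <= chord x y < 1.
  rewrite chord_ge0 lt_neqAle chord_le1 andbT; apply: contra_neq rnz => u1.
  apply/eqP; rewrite -sqrf_eq0; apply/eqP.
  by rewrite /r enorm_sqr u1 subrr mulr0.
have lr : - ln (1 - chord x y) = log_confN x + log_confN y + 2 * - ln r.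
  have := congr1 (@ln R) (enorm_sqr x y).
  rewrite -/r lnXn// !lnM ?posrE ?mulr_gt0 ?confN_gt0 ?subr_gt0 ?(proj2 (andP u1))//.
  by rewrite -mulr_natl /log_confN; lra.
rewrite /log_series nneseries_log// lr EFinD leeD2l// EFinM lee_pmul2l//.
have : exists J, 2 ^- J < r.
  have := @cvg_expr R 2^-1; rewrite ger0_norm// => /(_ _)/cvgrPdist_lt.
  move=> /(_ _ r rp) [|N _ HN]; first by rewrite invf_lt1// ltr1n.
  exists N; have := HN N (leqnn N); rewrite /= sub0r normrN ger0_norm ?exprn_ge0//.
  by rewrite exprVn.
move=> /ex_minnP[J rJ Jmin].
apply: (@le_trans _ _ (\sum_(0 <= j < J) (\1_(eball y (2 ^- j)) x : R)%:E)%E); last first.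
  by apply: nneseries_lim_ge => j _ _.
rewrite sumEFin lee_fin.
rewrite (@eq_big_nat _ _ _ _ _ _ (fun=> 1)); last first.
  move=> j /andP[_ jJ]; rewrite indicE mem_set// /eball/= -/r leNgt.
  by apply/negP => /Jmin; rewrite leqNgt jJ.
rewrite big_const_nat subn0 iter_addr_0.
have : ln (2 ^- J) <= ln r by rewrite ler_ln ?posrE ?invr_gt0 ?exprn_gt0// ltW.
rewrite lnV ?posrE ?exprn_gt0// lnXn// => h.
have l2 : ln 2 <= 1 :> R by apply: (@le_ln1Dx R 1); lra.
rewrite lerNl in h; apply: le_trans h _.
by rewrite lerMn2r l2 orbT.
Qed.

(** By [log_series_le] the potential of mu at y is at most log N y plus a constant,
    since the masses of the discs of radii 2^-j have a finite sum. *)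
Lemma frostman_energy_finite mu (C : R) : 0 <= C ->
  (\int[mu]_x (sqnorm x)%:E < +oo)%E ->
  (forall y (r : R), 0 <= r -> (mu (eball y r) <= (C * r)%:E)%E) ->
  (stereo_energy mu < +oo)%E.
Proof.
move=> C0 M2 ball.
have mlog : measurable_fun setT (EFin \o @log_confN R).
  by apply/measurable_EFinP; apply: continuous_measurable_plane; exact: continuous_log_confN.
have sq0 x : (0 <= (sqnorm x)%:E)%E by rewrite lee_fin sqnorm_ge0.
have lg0 x : (0 <= (log_confN x)%:E)%E by rewrite lee_fin log_confN_ge0.
have lgM2 : (\int[mu]_x (log_confN x)%:E < +oo)%E.
  apply: le_lt_trans M2; apply: ge0_le_integral => //; first exact: measurable_sqnorm.
  by move=> x _; rewrite lee_fin log_confN_le.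
have qM2 : (\int[mu]_x (ext_field x)%:E < +oo)%E.
  apply: le_lt_trans M2; apply: ge0_le_integral => //.
  - by move=> x _; rewrite lee_fin ext_field_ge0.
  - exact: measurable_ext_field.
  - exact: measurable_sqnorm.
  - by move=> x _; rewrite lee_fin gerBl log_confN_ge0.
have mind j y : measurable_fun setT (fun x => (\1_(eball y (2 ^- j)) x : R)%:E).
  by apply/measurable_EFinP; apply: measurable_indic; exact: measurable_eball.
have sum_ball y : (\int[mu]_x \sum_(j <oo) (\1_(eball y (2 ^- j)) x : R)%:E <= (2 * C)%:E)%E.
  rewrite integral_nneseries//.
  apply: (@le_trans _ _ (\sum_(j <oo) (2 * C / (2 ^ j.+1)%:R)%:E)%E); last first.
    by apply: epsilon_trick0; rewrite mulr_ge0.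
  apply: lee_nneseries => [j _ _|j _]; first exact: integral_ge0.
  rewrite integral_indic ?setIT//; last exact: measurable_eball.
  apply: le_trans (ball y (2 ^- j) _) _; first by rewrite invr_ge0 exprn_ge0.
  by rewrite lee_fin natrX exprS invfM mulrACA mulfV// mul1r.
have pot y : (log_potential mu y <= \int[mu]_x (log_confN x)%:E + (log_confN y)%:E + (4 * C)%:E)%E.
  apply: (@le_trans _ _ (\int[mu]_x (((log_confN x)%:E + (log_confN y)%:E) +
     2%:E * \sum_(j <oo) (\1_(eball y (2 ^- j)) x : R)%:E))%E).
    apply: ge0_le_integral => //.
    - by move=> x _; exact: log_series_ge0.
    - exact: measurable_log_series.
    - apply: emeasurable_funD; first exact: emeasurable_funD.
      by apply: emeasurable_funM => //; exact: ge0_emeasurable_sum.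
    - by move=> x _; rewrite -EFinD; exact: log_series_le.
  rewrite ge0_integralD//; last 4 first.
  - by move=> x _; rewrite adde_ge0.
  - exact: emeasurable_funD.
  - by move=> x _; rewrite mule_ge0// nneseries_ge0.
  - by apply: emeasurable_funM => //; exact: ge0_emeasurable_sum.
  rewrite ge0_integralD//.
  rewrite integral_cst_prob leeD2l//.
  rewrite ge0_integralZl_EFin//; last 2 first.
  - by move=> x _; exact: nneseries_ge0.
  - exact: ge0_emeasurable_sum.
  apply: (@le_trans _ _ (2%:E * (2 * C)%:E)%E); first by rewrite lee_pmul2l.
  by rewrite -EFinM lee_fin mulrA -natrM.
rewrite /stereo_energy -integral_log_potential.
have Lf : (\int[mu]_x (log_confN x)%:E \is a fin_num)%E.
  by rewrite ge0_fin_numE//; exact: integral_ge0.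
pose L := fine (\int[mu]_x (log_confN x)%:E)%E; rewrite -(fineK Lf) -/L in pot.
have L0 : 0 <= L by apply: fine_ge0; exact: integral_ge0.
apply: lte_add_pinfty => //; apply: lte_mul_pinfty => //.
have H : (\int[mu]_y log_potential mu y <=
    \int[mu]_y ((L%:E + (log_confN y)%:E) + (4 * C)%:E))%E.
  apply: ge0_le_integral => //.
  - by move=> y _; exact: log_potential_ge0.
  - exact: measurable_log_potential.
  - by apply: emeasurable_funD => //; exact: emeasurable_funD.
apply: (le_lt_trans H).
rewrite ge0_integralD//; last 3 first.
- by move=> y _; rewrite adde_ge0.
- exact: emeasurable_funD.
- by move=> y _; rewrite lee_fin mulr_ge0.
rewrite ge0_integralD//.
rewrite !integral_cst_prob -(fineK Lf) -!EFinD; exact: ltry.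
Qed.

End frostman.

(** * A probability of finite energy on the curve *)

Section pushforward_probability.
Context d1 d2 (T1 : measurableType d1) (T2 : measurableType d2) (R : realType).
Variables (P : probability T1 R) (f : T1 -> T2).
Hypothesis mf : measurable_fun setT f.

Lemma pushforward_probability : exists Q : probability T2 R,
  (forall A, Q A = P (f @^-1` A)) /\
  (forall h : T2 -> \bar R, measurable_fun setT h -> (forall y, 0 <= h y)%E ->
    (\int[Q]_y h y = \int[P]_x h (f x))%E).
Proof.
pose X : {mfun T1 >-> T2} := HB.pack f (isMeasurableFun.Build _ _ _ _ f mf).
exists (distribution P X); split => // h mh h0.
by rewrite ge0_integral_distribution.
Qed.
End pushforward_probability.

(** The probability is the image of the uniform one on a short parameter interval
    [0, l].  There the projection p of the curve to its tangent at 0 has derivative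
    at least 1/2, so that the parameters sent to a disc of radius r lie in an
    interval of length 8 r. *)
Section arc_measure.
Context {R : realType} (G : R -> R * R) (alpha : R).
Hypothesis hG : arc_length_parametrization G.
Hypothesis hH : C1_holder alpha G.
Hypothesis a0 : 0 < alpha.

Let e1 := (derive1 G 0).1.
Let e2 := (derive1 G 0).2.
Let p s := e1 * (G s).1 + e2 * (G s).2.
Let dp s := e1 * (derive1 G s).1 + e2 * (derive1 G s).2.

Let unit_e : e1 ^+ 2 + e2 ^+ 2 = 1.
Proof.
have [_] := hG 0; rewrite /enorm -/e1 -/e2 => e.
by rewrite -[LHS]sqr_sqrtr ?addr_ge0 ?sqr_ge0// e expr1n.
Qed.

Let cauchy_schwarz (z1 z2 r : R) : 0 <= r -> z1 ^+ 2 + z2 ^+ 2 <= r ^+ 2 ->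
  `|e1 * z1 + e2 * z2| <= r.
Proof.
move=> r0 zr; rewrite -(ler_pXn2r (ltn0Sn 1)) ?nnegrE// real_normK ?num_real//.
apply: le_trans zr.
have -> : z1 ^+ 2 + z2 ^+ 2 = (e1 * z1 + e2 * z2) ^+ 2 + (e1 * z2 - e2 * z1) ^+ 2.
  by rewrite -[LHS]mul1r -unit_e; ring.
by rewrite lerDl sqr_ge0.
Qed.

Let inner_sub (a b z1 z2 : R) : a ^+ 2 + b ^+ 2 = 1 ->
  a * (z1 - a) + b * (z2 - b) = a * z1 + b * z2 - 1.
Proof. by move=> <-; ring. Qed.

Let half_le (z : R) : - 2^-1 <= z - 1 -> 2^-1 <= z.
Proof. lra. Qed.

Let is_derive_p (s : R) : is_derive s 1 p (dp s).
Proof.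
have h1 := @is_deriveZ _ _ _ _ e1 _ _ _ (is_derive_fst hG s).
have h2 := @is_deriveZ _ _ _ _ e2 _ _ _ (is_derive_snd hG s).
exact: is_deriveD h1 h2.
Qed.

Let enorm_le (z : R * R) r : 0 <= r -> (enorm z <= r) = (z.1 ^+ 2 + z.2 ^+ 2 <= r ^+ 2).
Proof.
move=> r0; rewrite /enorm -(ler_pXn2r (ltn0Sn 1)) ?nnegrE ?sqrtr_ge0//.
by rewrite sqr_sqrtr// addr_ge0 ?sqr_ge0.
Qed.

(** The bound l is chosen so that K l^alpha = 1/2, where K dominates the Holder
    constant. *)
Let dp_ge : exists2 l, 0 < l & forall s, 0 <= s <= l -> 2^-1 <= dp s.
Proof.
have [_ [C HC]] := hH.
pose K := `|C| + 1.
have K0 : 0 < K by rewrite ltr_wpDl.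
pose l := (2 * K)^-1 `^ alpha^-1.
have l0 : 0 < l by rewrite powR_gt0// invr_gt0 mulr_gt0.
exists l => // s /andP[s0 sl].
have : enorm (derive1 G s - derive1 G 0) <= 2^-1.
  apply: le_trans (HC s 0) _; rewrite subr0 ger0_norm//.
  have sa : s `^ alpha <= (2 * K)^-1.
    rewrite (_ : (2 * K)^-1 = l `^ alpha).
      by apply: ge0_ler_powR; rewrite ?nnegrE ?(ltW a0) ?(ltW l0).
    by rewrite /l -powRrM mulVf ?gt_eqF// powRr1// invr_ge0 mulr_ge0// ltW.
  apply: (@le_trans _ _ (K * (2 * K)^-1)); last first.
    by rewrite invfM mulrCA mulfV ?gt_eqF// mulr1.
  apply: (@le_trans _ _ (K * s `^ alpha)); last by rewrite ler_pM2l.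
  by rewrite ler_wpM2r ?powR_ge0// (le_trans (ler_norm C))// lerDl.
have half0 : 0 <= 2^-1 :> R by [].
rewrite enorm_le// => h.
have : `|e1 * ((derive1 G s).1 - e1) + e2 * ((derive1 G s).2 - e2)| <= 2^-1.
  by apply: (cauchy_schwarz half0); exact: h.
rewrite inner_sub // -/(dp s).
by rewrite ler_norml => /andP[/half_le].
Qed.

Lemma exists_frostman_measure : exists mu : probability (R * R)%type R,
  mu (range G) = 1%E /\ (stereo_energy mu < +oo)%E.
Proof.
have [l l0 dpl] := dp_ge.
have pexp s t : 0 <= s <= l -> 0 <= t <= l -> `|s - t| / 2 <= `|p s - p t|.
  wlog st : s t / s <= t.
    move=> W sl tl; have [/W|/ltW/W] := leP s t; first exact.
    by rewrite distrC (distrC (p t)); apply.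
  move=> /andP[s0 sl] /andP[t0 tl].
  have [|c] := @MVT_segment R p dp s t st (fun x _ => is_derive_p x).
    apply: derivable_within_continuous => x _.
    by case: (is_derive_p x).
  rewrite in_itv/= => /andP[sc ct] e.
  rewrite distrC ger0_norm ?subr_ge0// (distrC (p s)) e.
  apply: le_trans (ler_norm _); rewrite mulrC ler_wpM2r ?subr_ge0//.
  by apply: dpl; rewrite (le_trans s0 sc) (le_trans ct tl).
pose P : probability (measurableTypeR R) R := uniform_prob l0.
have [mu [muE muI]] := pushforward_probability P (measurable_curve hG).
have lI : lebesgue_measure (`[0, l]%classic : set R) = l%:E.
  by rewrite lebesgue_measure_itv/= lte_fin l0 -EFinB subr0.
pose I0l : set (measurableTypeR R) := `[0, l]%classic.
have PE (A : set (measurableTypeR R)) : measurable A ->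
    (P A = (l^-1)%:E * lebesgue_measure (A `&` I0l))%E.
  move=> mA; have <- : (\int[P]_x ((\1_A x : R)%:E) = P A)%E by rewrite integral_indic ?setIT.
  rewrite integral_uniform//; last by apply/measurable_EFinP; exact: measurable_indic.
  by rewrite subr0 integral_indic.
exists mu; split.
  rewrite muE [X in P X](_ : _ = setT); first exact: (@probability_setT _ _ _ P).
  by apply/seteqP; split => // t _; exists t.
apply: (@frostman_energy_finite R mu (8 / l)).
- by rewrite divr_ge0// ltW.
- rewrite muI; last 2 first.
  + exact: measurable_sqnorm.
  + by move=> x; rewrite lee_fin sqnorm_ge0.
  rewrite integral_uniform//; last 2 first.
  + apply: (measurableT_comp (f := EFin \o sqnorm)); first exact: measurable_sqnorm.
    exact: measurable_curve.
  + by move=> x; rewrite lee_fin sqnorm_ge0.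
  pose B := (`|(G 0).1| + l) ^+ 2 + (`|(G 0).2| + l) ^+ 2.
  apply: lte_mul_pinfty => //; first by rewrite lee_fin invr_ge0 subr0 ltW.
  apply: (@le_lt_trans _ _ (\int[lebesgue_measure]_(x in I0l) (cst B%:E x))%E).
    apply: ge0_le_integral => //.
    + by move=> x _; rewrite lee_fin sqnorm_ge0.
    + apply: measurable_funTS; apply: (measurableT_comp (f := EFin \o sqnorm)).
        exact: measurable_sqnorm.
      exact: measurable_curve.
    + move=> s /=; rewrite in_itv/= => /andP[s0 sl]; rewrite lee_fin.
      have b1 := curve_fst_lipschitz hG s 0; have b2 := curve_snd_lipschitz hG s 0.
      rewrite subr0 (ger0_norm s0) in b1; rewrite subr0 (ger0_norm s0) in b2.
      have c1 : `|(G s).1| <= `|(G 0).1| + l.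
        rewrite -[(G s).1](subrK (G 0).1) addrC (le_trans (ler_normD _ _))// lerD2l.
        exact: le_trans b1 sl.
      have c2 : `|(G s).2| <= `|(G 0).2| + l.
        rewrite -[(G s).2](subrK (G 0).2) addrC (le_trans (ler_normD _ _))// lerD2l.
        exact: le_trans b2 sl.
      rewrite /sqnorm /B -(real_normK (num_real (G s).1)) -(real_normK (num_real (G s).2)).
      by apply: lerD; rewrite lerXn2r ?nnegrE// addr_ge0// ltW.
  rewrite integral_cst; last exact: measurable_itv.
  have -> : (B%:E * lebesgue_measure I0l = B%:E * l%:E)%E by congr (_ * _)%E; exact: lI.
  by rewrite -EFinM ltry.
move=> y r r0; rewrite muE PE; last first.
  by rewrite -[X in measurable X]setTI; apply: (measurable_curve hG) => //; exact: measurable_eball.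
set A := _ `&` _.
have Ap s : A s -> 0 <= s <= l /\ `|p s - (e1 * y.1 + e2 * y.2)| <= r.
  move=> [/= As]; rewrite /I0l /= in_itv/= => sl; split => //.
  have -> : p s - (e1 * y.1 + e2 * y.2) = e1 * ((G s).1 - y.1) + e2 * ((G s).2 - y.2).
    by rewrite /p; ring.
  by apply: cauchy_schwarz => //; rewrite -(enorm_le (G s - y)).
have [[t At]|A0] := pselect (A !=set0); last first.
  have -> : A = set0 by apply: contrapT => /eqP/set0P.
  by rewrite measure0 mule0 lee_fin mulr_ge0// divr_ge0// ltW.
have [tl pt] := Ap _ At.
have sub : A `<=` `[t - 4 * r, t + 4 * r]%classic.
  move=> s As; have [sl ps] := Ap _ As.
  have : `|s - t| <= 4 * r.
    have := pexp _ _ sl tl.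
    have : `|p s - p t| <= 2 * r.
      rewrite -(subrKA (e1 * y.1 + e2 * y.2)) (le_trans (ler_normD _ _))//.
      rewrite distrC in pt; lra.
    lra.
  by rewrite ler_distlC /= in_itv/= => /andP[? ?]; apply/andP; split; lra.
have mA : measurable A.
  apply: measurableI; last exact: measurable_itv.
  by rewrite -[X in measurable X]setTI; apply: (measurable_curve hG) => //; exact: measurable_eball.
have : (lebesgue_measure A <= (8 * r)%:E)%E.
  apply: (@le_trans _ _ (lebesgue_measure `[t - 4 * r, t + 4 * r]%classic)).
    apply: le_measure; [|rewrite inE; exact: measurable_itv|exact: sub].
    by rewrite inE; exact: mA.
  rewrite lebesgue_measure_itv/= lte_fin; case: ifP => _.
    by rewrite -EFinB lee_fin; lra.
  by rewrite lee_fin mulr_ge0.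
move=> h; apply: le_trans (lee_wpmul2l _ h) _; first by rewrite lee_fin invr_ge0 ltW.
by rewrite -EFinM lee_fin mulrA (mulrC l^-1).
Qed.

End arc_measure.

(** * Lower semicontinuity and existence of minimizers *)

Section lower_semicontinuity.
Context {R : realType} (U : set_system nat) {FU : UltraFilter U}.
Variables (mu_ : nat -> probability (R * R)%type R) (tau : probability (R * R)%type R).
Hypothesis mu_tau : portmanteau_limit U mu_ tau.

(** Half of the convergence of the integrals of g; the other half is this one for
    - g. *)
Let portmanteau_shift (g : R * R -> R) (e : R) : continuous g ->
  (forall x, `|g x| <= 1) -> 0 < e ->
  \forall n \near U, fine (\int[tau]_x (g x)%:E) - e < fine (\int[mu_ n]_x (g x)%:E).
Proof.
move=> cg g1 e0.
have ig (P : probability (R * R)%type R) : P.-integrable setT (EFin \o g).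
  by apply: bounded_integrable g1; exact: continuous_measurable_plane.
have shift (P : probability (R * R)%type R) :
    (\int[P]_x (g x + 1)%:E = (fine (\int[P]_x (g x)%:E) + 1)%:E)%E.
  under eq_integral do rewrite EFinD.
  rewrite integralD//; [|exact: ig|exact: (@bounded_integrable _ _ _ P (cst 1) `|1|)].
  by rewrite integral_cst_prob EFinD fineK//; apply: integrable_fin_num => //; exact: ig.
have [//|H] := in_ultra_setVsetC
  [set n | fine (\int[tau]_x (g x)%:E) - e < fine (\int[mu_ n]_x (g x)%:E)] FU.
have := @portmanteau_integral R U FU mu_ tau mu_tau (fun x => g x + 1)
  (fine (\int[tau]_x (g x)%:E) - e + 1).
rewrite shift lee_fin lerD2r => h.
have {h} : fine (\int[tau]_x (g x)%:E) <= fine (\int[tau]_x (g x)%:E) - e.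
  apply: h.
  - by move=> x; apply: cvgD; [exact: cg|exact: cvg_cst].
  - by move=> x; have := g1 x; rewrite ler_norml -lerBlDr sub0r => /andP[].
  - apply: filterS H => n /= /negP; rewrite -leNgt => nH.
    by rewrite shift lee_fin lerD2r.
by rewrite lerDl oppr_ge0 leNgt e0.
Qed.

Lemma moment_cvg k (f : {ffun 'I_k -> 'I_4}) :
  moment (mu_ n) f @[n --> U] --> moment tau f.
Proof.
apply/cvgrPdist_lt => e e0.
have h1 := portmanteau_shift (@continuous_stereo_mono R k f) (stereo_mono_norm_le1 f) e0.
have cN : continuous (fun x : R * R => - stereo_mono f x).
  by move=> x; apply: cvgN; exact: continuous_stereo_mono.
have bN (x : R * R) : `|- stereo_mono f x| <= 1 by rewrite normrN stereo_mono_norm_le1.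
have h2 := portmanteau_shift cN bN e0.
have intN (P : probability (R * R)%type R) :
    fine (\int[P]_x (- stereo_mono f x)%:E) = - moment P f.
  under eq_integral do rewrite EFinN.
  rewrite integralN; last exact: integrable_add_def (integrable_stereo_mono P f).
  by rewrite momentE.
near=> n.
have h1n : moment tau f - e < moment (mu_ n) f by near: n; exact: h1.
have : - moment tau f - e < - moment (mu_ n) f.
  by rewrite -!intN; near: n; exact: h2.
by move=> h2n; rewrite ltr_distlC; apply/andP; split; lra.
Unshelve. all: by end_near. Qed.

Definition moment_partial (mu : probability (R * R)%type R) K : R :=
  \sum_(0 <= k < K) moment_sqnorm mu k.+1 / k.+1%:R.

Lemma moment_partial_cvg K :
  moment_partial (mu_ n) K @[n --> U] --> moment_partial tau K.
Proof.
apply: cvg_big => [|k _]; first exact: add_continuous.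
apply: cvgMl; apply: cvg_big => [|f _]; first exact: add_continuous.
by apply: cvgM; exact: moment_cvg.
Qed.

Lemma moment_partial_le (mu : probability (R * R)%type R) K :
  (\int[mu]_x (ext_field x)%:E + (2^-1 * moment_partial mu K)%:E <= stereo_energy mu)%E.
Proof.
rewrite leeD2l// EFinM lee_wpmul2l ?lee_fin// -sumEFin.
by apply: nneseries_lim_ge => k _ _; rewrite lee_fin divr_ge0// moment_sqnorm_ge0.
Qed.

(** For each K the first K squares converge, and the integral of the external field
    is lower semicontinuous; the supremum over K gives the claim. *)
Lemma stereo_energy_lsc (c : R) :
  (\forall n \near U, (stereo_energy (mu_ n) <= c%:E)%E) ->
  (stereo_energy tau <= c%:E)%E.
Proof.
move=> H.
have q0 (P : probability (R * R)%type R) : (0 <= \int[P]_x (ext_field x)%:E)%E.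
  by apply: integral_ge0 => x _; rewrite lee_fin ext_field_ge0.
have part K : (\int[tau]_x (ext_field x)%:E <= (c - 2^-1 * moment_partial tau K)%:E)%E.
  apply/lee_addgt0Pr => e e0; rewrite -EFinD.
  apply: (portmanteau_integral mu_tau (@continuous_ext_field R)).
    exact: ext_field_ge0.
  have /cvgrPdist_lt /(_ e e0) cK := @moment_partial_cvg K.
  near=> n.
  have Hn : (stereo_energy (mu_ n) <= c%:E)%E by near: n; exact: H.
  have cKn : `|moment_partial tau K - moment_partial (mu_ n) K| < e.
    by near: n; exact: cK.
  have := le_trans (moment_partial_le (mu_ n) K) Hn.
  rewrite -leeBrDr// -EFinB => /le_trans; apply; rewrite lee_fin.
  by move: cKn; rewrite ltr_norml => /andP[]; lra.
have Qfin : (\int[tau]_x (ext_field x)%:E \is a fin_num)%E.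
  by rewrite ge0_fin_numE// (le_lt_trans (part 0%N))// ltry.
move: part; rewrite /stereo_energy -(fineK Qfin); set Q := fine _ => part.
have S : (\sum_(k <oo) (moment_sqnorm tau k.+1 / k.+1%:R)%:E <= (2 * (c - Q))%:E)%E.
  apply: lime_le.
    by apply: is_cvg_nneseries => k _ _; rewrite lee_fin divr_ge0// moment_sqnorm_ge0.
  apply: nearW => K; rewrite sumEFin lee_fin -/(moment_partial tau K).
  by have := part K; rewrite lee_fin; lra.
apply: (@le_trans _ _ (Q%:E + 2^-1%:E * (2 * (c - Q))%:E)%E).
  by rewrite leeD2l// lee_wpmul2l ?lee_fin.
by rewrite -EFinM -EFinD lee_fin; lra.
Unshelve. all: by end_near. Qed.

End lower_semicontinuity.

Section existence.
Context {R : realType}.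
Implicit Types mu : probability (R * R)%type R.

Lemma stereo_energy_ge0 mu : (0 <= stereo_energy mu)%E.
Proof.
rewrite adde_ge0//; first by apply: integral_ge0 => x _; rewrite lee_fin ext_field_ge0.
rewrite mule_ge0 ?lee_fin//; apply: nneseries_ge0 => k _ _.
by rewrite lee_fin divr_ge0// moment_sqnorm_ge0.
Qed.

(** All terms of the energy being nonnegative, c bounds the integral of the external
    field, and Markov's inequality applies. *)
Lemma energy_sublevel_tight (c e : R) : 0 < e ->
  exists2 K : set (R * R), compact K &
    forall mu, (stereo_energy mu <= c%:E)%E -> ((1 - e)%:E <= mu K)%E.
Proof.
move=> e0.
pose B := (`|c| + 1) / e.
have B0 : 0 < B by rewrite divr_gt0// ltr_wpDl.
(* Half of the side of a square outside of which the external field exceeds B. *)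
pose m := 2 + 2 * B.
pose K : set (R * R) := `[- m, m]%classic `*` `[- m, m]%classic.
have mK : measurable K by apply: measurableX; exact: measurable_itv.
exists K; first by apply: compact_setX; exact: segment_compact.
move=> mu Emu.
have qB x : (~` K) x -> B <= ext_field x.
  move=> nK; apply: le_trans (ext_field_ge x).
  have m0 : 0 <= m by rewrite /m; lra.
  suff : m ^+ 2 <= sqnorm x.
    have mB : 2 * (B + 1) <= m ^+ 2.
      by have : 0 <= B ^+ 2 := sqr_ge0 B; rewrite /m; nra.
    lra.
  have [x1|x1] := leP m `|x.1|.
    rewrite /sqnorm -(real_normK (num_real x.1)).
    apply: (@le_trans _ _ (`|x.1| ^+ 2)); last by rewrite lerDl sqr_ge0.
    by rewrite lerXn2r ?nnegrE.
  have [x2|x2] := leP m `|x.2|.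
    rewrite /sqnorm -(real_normK (num_real x.2)).
    apply: (@le_trans _ _ (`|x.2| ^+ 2)); last by rewrite lerDr sqr_ge0.
    by rewrite lerXn2r ?nnegrE.
  exfalso; apply: nK; split; rewrite /= in_itv/=.
    by rewrite -ler_norml ltW.
  by rewrite -ler_norml ltW.
have mC : measurable (~` K) by exact: measurableC.
have qc : (\int[mu]_x (ext_field x)%:E <= c%:E)%E.
  apply: le_trans Emu; rewrite leeDl// mule_ge0 ?lee_fin//; apply: nneseries_ge0 => k _ _.
  by rewrite lee_fin divr_ge0// moment_sqnorm_ge0.
have : (B%:E * mu (~` K) <= c%:E)%E.
  apply: le_trans qc.
  have <- : (\int[mu]_x (B%:E * (\1_(~` K) x : R)%:E) = B%:E * mu (~` K))%E.
    rewrite ge0_integralZl_EFin//; last 2 first.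
    - by apply/measurable_EFinP; exact: measurable_indic.
    - exact: ltW.
    by rewrite integral_indic// setIT.
  apply: ge0_le_integral => //.
  - by move=> x _; rewrite -EFinM lee_fin mulr_ge0// ltW.
  - apply: emeasurable_funM => //.
    by apply/measurable_EFinP; exact: measurable_indic.
  - exact: measurable_ext_field.
  - move=> x _; rewrite -EFinM lee_fin indicE.
    have [|_] := boolP (x \in ~` K); last by rewrite mulr0 ext_field_ge0.
    by rewrite inE mulr1 => /qB.
rewrite probability_setC// -(fineK (fin_num_measure mu _ mK)) -EFinB -EFinM !lee_fin.
set p := fine _ => Bc.
have : B * (1 - p) <= B * e.
  apply: (le_trans Bc); rewrite /B divfK ?gt_eqF//.
  by rewrite (le_trans (ler_norm c))// lerDl.
by rewrite ler_pM2l//; lra.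
Qed.

(** The direct method: the constraint enters only through its stability under
    weak limits and the existence of one competitor of finite energy. *)
Lemma exists_minimizer (M : set (probability (R * R)%type R)) :
  (forall (U : set_system nat) (FU : UltraFilter U)
      (mu_ : nat -> probability (R * R)%type R) (tau : probability (R * R)%type R),
    (forall n, M (mu_ n)) -> portmanteau_limit U mu_ tau -> M tau) ->
  (exists2 mu, M mu & (stereo_energy mu < +oo)%E) ->
  exists2 tau, M tau & exists2 e : R, stereo_energy tau = e%:E &
    forall mu, M mu -> (e%:E <= stereo_energy mu)%E.
Proof.
move=> Mclosed [mu0 Mmu0 mu0fin].
pose S := [set stereo_energy mu | mu in M].
have S0 : (0 <= ereal_inf S)%E.
  by apply: le_ereal_inf_tmp => _ [mu _ <-]; exact: stereo_energy_ge0.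
have Sfin : ereal_inf S \is a fin_num.
  rewrite ge0_fin_numE//; apply: le_lt_trans mu0fin.
  by apply: ereal_inf_lbound; exists mu0.
pose e := fine (ereal_inf S).
have eE : e%:E = ereal_inf S by rewrite fineK.
have emin mu : M mu -> (e%:E <= stereo_energy mu)%E.
  by move=> Mmu; rewrite eE; apply: ereal_inf_lbound; exists mu.
have seq n : exists mu, M mu /\ (stereo_energy mu <= (e + n.+1%:R^-1)%:E)%E.
  have n0 : 0 < n.+1%:R^-1 :> R by rewrite invr_gt0.
  have [_ [mu Mmu <-] h] := lb_ereal_inf_adherent n0 Sfin.
  by exists mu; split => //; rewrite EFinD eE; exact: ltW.
have [mu_ mu_P] := choice seq.
have [U [FU ooU]] := ultraFilterLemma (@eventually_filter).
have [d d0|tau mu_tau] := @tight_portmanteau_limit R U FU mu_.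
  have [K cK KP] := @energy_sublevel_tight (e + 1) d d0.
  exists K => // n; apply: KP; apply: le_trans (proj2 (mu_P n)) _.
  by rewrite lee_fin lerD2l invf_le1// ler1n.
have Mtau : M tau by apply: Mclosed mu_tau => n; case: (mu_P n).
exists tau => //; exists e => //.
apply/eqP; rewrite eq_le emin// andbT.
apply/lee_addgt0Pr => d d0; rewrite -EFinD.
apply: (stereo_energy_lsc mu_tau).
apply: ooU.
have [N _ HN] := near_infty_natSinv_lt (PosNum d0).
exists N => // n Nn; apply: le_trans (proj2 (mu_P n)) _.
by rewrite lee_fin lerD2l ltW//; exact: HN.
Qed.

End existence.

(** * Existence and uniqueness of the minimizer *)

Unset Implicit Arguments.

Theorem theorem2p1 (R : realType) (a alpha : R) (G : R -> R * R)
  (ha : 0 < a < 1) (halpha : 0 < alpha < 1)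
  (hreg : arc_length_parametrization G)
  (hsmooth : C1_holder alpha G)
  (hlen : locally_finite_length G)
  (hsimple : no_self_intersections G) :
  exists mu : probability (R * R)%type R,
    [/\ curve_mass_ge a G mu,
        energy mu = ereal_inf (@energy R @` curve_mass_ge a G) &
        forall nu : probability (R * R)%type R,
          curve_mass_ge a G nu ->
          energy nu = ereal_inf (@energy R @` curve_mass_ge a G) ->
          same_measure nu mu].
Proof.
have cG : closed (range G) by exact: closed_curve_range.
have mG : measurable (range G) by exact: closed_measurable_plane.
have [mu0 [mu0G mu0fin]] := exists_frostman_measure hreg hsmooth (proj1 (andP halpha)).
have [U FU mu_ tau mu_M mu_tau||tau Mtau [e tauE emin]] :=
  @exists_minimizer R (curve_mass_ge a G).
- apply: (portmanteau_closed mu_tau cG).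
  by apply: filterE => n; exact: mu_M.
- exists mu0 => //; rewrite /curve_mass_ge /= mu0G lee_fin ltW//.
  by case/andP: ha.
have infE : ereal_inf (@energy R @` curve_mass_ge a G) = e%:E.
  apply/eqP; rewrite eq_le; apply/andP; split.
    by apply: ereal_inf_lbound; exists tau => //; rewrite energyE.
  by apply: le_ereal_inf_tmp => _ [mu Mmu <-]; rewrite energyE emin.
exists tau; split => //; first by rewrite infE energyE.
move=> nu Mnu; rewrite infE energyE => nuE.
apply: (stereo_energy_midpoint_min nuE tauE); apply: emin.
rewrite /curve_mass_ge /= midpointE.
apply: (@le_trans _ _ (2^-1%:E * a%:E + 2^-1%:E * a%:E)%E).
  by rewrite -EFinM -EFinD lee_fin; lra.
by apply: leeD; rewrite lee_pmul2l// lte_fin invr_gt0.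
Qed.
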